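(* Let $\mathbf V$ be a pseudovariety of semigroups with $\mathbf V\nsubseteq\mathbf{LI}$, and let $\kappa$ be the canonical implicit signature consisting of the multiplication and the $(\omega-1)$-power. If $\mathbf V$ is pointlike $\kappa$-reducible, then $\mathbf V*\mathbf D$ is pointlike $\kappa$-reducible.
   Context: All alphabets are finite. $\mathbf S$ is the pseudovariety of all finite semigroups, $\mathbf{LI}=\llbracket x^\omega yx^\omega=x^\omega\rrbracket$ and $\mathbf D=\llbracket yx^\omega=x^\omega\rrbracket$. $\mathbf V*\mathbf D$ is the pseudovariety generated by all semidirect products $S*T$ with $S\in\mathbf V$, $T\in\mathbf D$, where $T$ acts on the left of $S$ by endomorphisms and $(s,t)(s',t')=(s\cdot{}^{t}s',tt')$. In a compact semigroup, $s^\omega$ is the unique idempotent in the closed subsemigroup generated by $s$, and $s^{\omega-1}$ is the inverse of $s^{\omega+1}=s^\omega s$ in the maximal closed subgroup containing $s^\omega$. $\overline\Omega_A\mathbf V$ is the pro-$\mathbf V$ semigroup freely generated by $A$; $p_{\mathbf V}:\overline\Omega_A\mathbf S\to\overline\Omega_A\mathbf V$ is the continuous homomorphism fixing the generators. For $\pi,\rho\in\overline\Omega_A\mathbf S$, $\mathbf V\models\pi=\rho$ means $p_{\mathbf V}\pi=p_{\mathbf V}\rho$ (extended to $(\overline\Omega_A\mathbf S)^1$ by $p_{\mathbf V}1=1$). $\Omega_A^\kappa\mathbf S$ is the smallest subset of $\overline\Omega_A\mathbf S$ containing $A$ and closed under multiplication and $(\omega-1)$-power. Reducibility. Let $\Sigma$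 be a finite set of equations over a finite alphabet $X$, $S$ a finite $A$-generated semigroup, $\delta:\overline\Omega_A\mathbf S\to S$ the continuous homomorphism respecting the choice of generators (extended by $\delta1=1$), and $\varphi:X\to S^1$ a mapping. A mapping $\eta:X\to(\overline\Omega_A\mathbf S)^1$ is a $\mathbf V$-solution of $\Sigma$ with respect to $(\varphi,\delta)$ if $\delta\eta=\varphi$ and $\mathbf V\models\overline\eta u=\overline\eta v$ for all $(u=v)\in\Sigma$, where $\overline\eta$ is the natural extension of $\eta$. It is a $(\mathbf V,\kappa)$-solution if moreover $\eta X\subseteq(\Omega_A^\kappa\mathbf S)^1$. $\mathbf V$ is $\kappa$-reducible relatively to $\Sigma$ if, for every such pair $(\varphi,\delta)$, the existence of a $\mathbf V$-solution of $\Sigma$ with respect to $(\varphi,\delta)$ entails the existence of a $(\mathbf V,\kappa)$-solution with respect to the same pair. $\mathbf V$ is pointlike $\kappa$-reducible if it is $\kappa$-reducible relatively to every system of equations of the form $x_1=x_2=\cdots=x_m$ with $m\ge2$. *)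

(* Defs.v *)
From HB Require Import structures.
From mathcomp Require Import all_boot.
From mathcomp Require Import boolp classical_sets functions topology.

Set Implicit Arguments.
Unset Strict Implicit.
Unset Printing Implicit Defensive.

Local Open Scope classical_set_scope.
Local Open Scope group_scope.

(* The empty semigroup is allowed as a finite semigroup.  By [pv_trivial] and
   [pv_sub] it belongs to every pseudovariety, so this does not change the
   lattice of pseudovarieties. *)
#[short(type="finSemigroupType")]
HB.structure Definition FinSemigroup := {S of Semigroup S & Finite S}.

HB.mixin Record isTopologicalSemigroup S of Semigroup S & Topological S := {
  mulg_continuous : continuous (fun xy : S * S => xy.1 * xy.2)
}.

#[short(type="topologicalSemigroupType")]
HB.structure Definition TopologicalSemigroup :=
  {S of Semigroup S & Topological S & isTopologicalSemigroup S}.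

Definition subsemigroup (S : magmaType) (B : set S) : Prop :=
  forall x y, B x -> B y -> B (x * y).

Definition subsemigroup_gen (S : magmaType) : set S -> set S :=
  smallest (@subsemigroup S).

Definition closed_subsemigroup_gen (S : topologicalSemigroupType) :
  set S -> set S := smallest (fun B => closed B /\ subsemigroup B).

Lemma mul_fun_continuous (X : topologicalType) (S : topologicalSemigroupType)
    (f g : X -> S) :
  continuous f -> continuous g -> continuous (fun x => f x * g x).
Proof.
move=> cf cg x.
exact: cvg_comp (cvg_pair (cf x) (cg x)) (mulg_continuous (f x, g x)).
Qed.

Section Powers.
Variable S : topologicalSemigroupType.
Implicit Types s e t : S.

Definition is_omega s e : Prop :=
  closed_subsemigroup_gen [set s] e /\ e * e = e.

Definition closed_subgroup_at e (G : set S) : Prop :=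
  [/\ closed G, subsemigroup G, G e, (forall x, G x -> e * x = x /\ x * e = x)
    & forall x, G x -> exists2 y, G y & x * y = e /\ y * x = e].

Definition is_maximal_closed_subgroup_at e (G : set S) : Prop :=
  closed_subgroup_at e G /\
  forall H, closed_subgroup_at e H -> H `<=` G.

Definition is_omega_minus1 s t : Prop :=
  exists e G, [/\ is_omega s e, is_maximal_closed_subgroup_at e G,
    G (e * s), G t & (e * s) * t = e /\ t * (e * s) = e].

End Powers.

HB.instance Definition _ (S : semigroupType) :=
  Semigroup.copy (discrete_topology S) S.

Fact discrete_mulg_continuous (S : semigroupType) :
  continuous (fun xy : discrete_topology S * discrete_topology S =>
    xy.1 * xy.2).
Proof.
move=> [x y] U /principal_filterP Uxy.
exists ([set x], [set y]); first by split; exact: discrete_set1.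
by case=> a b /= [-> ->].
Qed.
HB.instance Definition _ (S : semigroupType) :=
  isTopologicalSemigroup.Build (discrete_topology S)
    (@discrete_mulg_continuous S).

HB.instance Definition _ (S T : finSemigroupType) := Semigroup.on (S * T)%type.

(* [set finSemigroupType] would force the carriers into a universe too small
   to contain the ordinals ['I_n]. *)
Definition semigroup_class := finSemigroupType -> Prop.

Record pseudovariety (V : semigroup_class) : Prop := {
  pv_trivial : forall S : finSemigroupType, #|S| = 1%N -> V S;
  pv_prod : forall S T : finSemigroupType, V S -> V T -> V (S * T)%type;
  pv_sub : forall (S T : finSemigroupType) (f : {multiplicative S -> T}),
    injective f -> V T -> V S;
  pv_image : forall (S T : finSemigroupType) (f : {multiplicative S -> T}),
    range f = setT -> V S -> V T
}.

Definition generated_pv (K : semigroup_class) : semigroup_class := fun S =>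
  forall V, pseudovariety V -> (forall T, K T -> V T) -> V S.

Definition LI : semigroup_class := fun S : finSemigroupType =>
  forall x y e : discrete_topology S, is_omega x e -> e * y * e = e.

Definition D : semigroup_class := fun S : finSemigroupType =>
  forall x y e : discrete_topology S, is_omega x e -> y * e = e.

Record left_action (S T : semigroupType) (act : T -> S -> S) : Prop := {
  act_mul : forall t t' s, act (t * t') s = act t (act t' s);
  act_endo : forall t s s', act t (s * s') = act t s * act t s'
}.

Section Semidirect.
Variables (S T : semigroupType) (act : T -> S -> S) (actP : left_action act).

Definition semidirect_of (_ : left_action act) : Type := (S * T)%type.
Local Notation R := (semidirect_of actP).

Definition semidirect_mul (x y : R) : R := (x.1 * act x.2 y.1, x.2 * y.2).

HB.instance Definition _ := Choice.on R.

Fact semidirect_mulA : associative semidirect_mul.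
Proof.
move=> [s t] [s' t'] [s2 t2]; congr (_, _) => /=; last exact: mulgA.
by rewrite (act_mul actP) (act_endo actP) mulgA.
Qed.
HB.instance Definition _ := isSemigroup.Build R semidirect_mulA.
End Semidirect.

HB.instance Definition _ (S T : finSemigroupType) (act : T -> S -> S)
  (actP : left_action act) := Finite.on (semidirect_of actP).

Inductive semidirect_products (V W : semigroup_class) :
    finSemigroupType -> Prop :=
  SemidirectProduct (S T : finSemigroupType) (act : T -> S -> S)
    (actP : left_action act) of V S & W T :
  semidirect_products V W (semidirect_of actP).

Definition semidirect_pv (V W : semigroup_class) : semigroup_class :=
  generated_pv (semidirect_products V W).

(* Every finite semigroup is isomorphic to one of these.  They form a small
   type, so that products indexed by them stay in the universe of
   [topologicalType]. *)
Record ord_semigroup := OrdSemigroup {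
  ord_size : nat;
  ord_mul : 'I_ord_size -> 'I_ord_size -> 'I_ord_size;
  ord_mulA : associative ord_mul
}.

Definition ord_carrier (S : ord_semigroup) : Type := 'I_(ord_size S).
HB.instance Definition _ (S : ord_semigroup) := Finite.on (ord_carrier S).
HB.instance Definition _ (S : ord_semigroup) :=
  isSemigroup.Build (ord_carrier S) (@ord_mulA S).
Coercion ord_carrier_fin (S : ord_semigroup) : finSemigroupType :=
  ord_carrier S.

Record valuation (V : semigroup_class) (A : Type) := Valuation {
  val_cod : ord_semigroup;
  val_codP : V val_cod;
  val_fun : A -> val_cod
}.

Lemma prod_topology_continuous (X : topologicalType) (I : Type)
    (T : I -> topologicalType) (f : X -> prod_topology T) :
  (forall i, continuous (fun x => f x i)) -> continuous f.
Proof.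
move=> cf x; apply/cvg_sup => i U [V [[W oW <-] Wfx] sWU].
by apply: filterS sWU _; apply: (cf i x); exact: open_nbhs_nbhs.
Qed.

Lemma prod_topology_proj (I : Type) (T : I -> topologicalType) (i : I) :
  continuous (fun x : prod_topology T => x i).
Proof.
move=> x U Ux; have /cvg_sup/(_ i) cx : x --> x by exact: cvg_id.
exact/cx/(@initial_continuous _ _ (fun y : forall i, T i => y i)).
Qed.

Section Ambient.
Variables (V : semigroup_class) (A : Type).

Definition valuation_product : Type :=
  prod_topology (fun i : valuation V A => discrete_topology (val_cod i)).
HB.instance Definition _ := Topological.on valuation_product.

Definition valuation_product_mul (x y : valuation_product) :
  valuation_product := fun i => x i * y i.
Fact valuation_product_mulA : associative valuation_product_mul.
Proof.
by move=> x y z; apply: functional_extensionality_dep => i; exact: mulgA.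
Qed.
HB.instance Definition _ :=
  isSemigroup.Build valuation_product valuation_product_mulA.

Fact valuation_product_mul_continuous : continuous
  (fun xy : valuation_product * valuation_product => xy.1 * xy.2).
Proof.
apply: prod_topology_continuous => i.
apply: (@mul_fun_continuous _ (discrete_topology (val_cod i))) => xy.
- apply: (@continuous_comp _ _ _ fst (fun x : valuation_product => x i)).
    exact: cvg_fst.
  exact: prod_topology_proj.
- apply: (@continuous_comp _ _ _ snd (fun x : valuation_product => x i)).
    exact: cvg_snd.
  exact: prod_topology_proj.
Qed.
HB.instance Definition _ := isTopologicalSemigroup.Build valuation_product
  valuation_product_mul_continuous.

Definition valuation_gen (a : A) : valuation_product := fun i => val_fun i a.

(* The pro-V semigroup freely generated by A, as the closed subsemigroup
   generated by A in the product of all the maps from A to members of V. *)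
Definition Omega : Type :=
  set_type (closed_subsemigroup_gen (range valuation_gen)).
HB.instance Definition _ := Topological.on Omega.
HB.instance Definition _ := SubType.on Omega.

Fact Omega_genP a : valuation_gen a
  \in closed_subsemigroup_gen (range valuation_gen).
Proof. by apply/mem_set => B [_ gB]; apply: gB; exists a. Qed.
Definition Omega_gen (a : A) : Omega := SigSub (Omega_genP a).

Fact Omega_mulP (x y : Omega) :
  val x * val y \in closed_subsemigroup_gen (range valuation_gen).
Proof.
apply/mem_set => B [[cB mB] gB].
have Bval (z : Omega) : B (val z) := set_valP z B (conj (conj cB mB) gB).
exact: mB.
Qed.
Definition Omega_mul (x y : Omega) : Omega := SigSub (Omega_mulP x y).

Fact Omega_mulA : associative Omega_mul.
Proof. by move=> x y z; apply: val_inj; exact: (@mulgA valuation_product). Qed.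
HB.instance Definition _ := isSemigroup.Build Omega Omega_mulA.

Lemma val_Omega_continuous : continuous (val : Omega -> valuation_product).
Proof. exact: initial_continuous. Qed.

Fact Omega_mul_continuous : continuous (fun xy : Omega * Omega => xy.1 * xy.2).
Proof.
apply: continuous_comp_initial.
apply: (@mul_fun_continuous _ valuation_product) => xy.
- apply: (@continuous_comp _ _ _ fst (val : Omega -> _)).
    exact: cvg_fst.
  exact: val_Omega_continuous.
- apply: (@continuous_comp _ _ _ snd (val : Omega -> _)).
    exact: cvg_snd.
  exact: val_Omega_continuous.
Qed.
HB.instance Definition _ :=
  isTopologicalSemigroup.Build Omega Omega_mul_continuous.
End Ambient.

Definition all_semigroups : semigroup_class := fun _ => True.

Notation OmegaS A := (Omega all_semigroups A).

Section Projection.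
Variables (V : semigroup_class) (A : Type).

Definition valuation_all (i : valuation V A) : valuation all_semigroups A :=
  @Valuation all_semigroups A (val_cod i) Logic.I (val_fun i).

Definition restrict_valuations (x : valuation_product all_semigroups A) :
  valuation_product V A := fun i => x (valuation_all i).

Lemma restrict_valuations_continuous : continuous restrict_valuations.
Proof.
apply: prod_topology_continuous => i.
exact: (@prod_topology_proj _
  (fun j : valuation all_semigroups A => discrete_topology (val_cod j))
  (valuation_all i)).
Qed.

Fact pV_subproof (x : OmegaS A) : restrict_valuations (val x)
  \in closed_subsemigroup_gen (range (@valuation_gen V A)).
Proof.
apply/mem_set => B [[cB mB] gB].
apply: (set_valP x (restrict_valuations @^-1` B)).
split; last first.
  by move=> _ [a _ <-]; apply: gB; exists a.
split; last by move=> y z By Bz; exact: mB By Bz.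
by apply: preimage_closed cB => y _; exact: restrict_valuations_continuous.
Qed.

(* The continuous homomorphism fixing the generators: it keeps the coordinates
   indexed by the maps into members of V; see [pVM], [pV_continuous] and
   [pV_gen]. *)
Definition pV (x : OmegaS A) : Omega V A := SigSub (pV_subproof x).

Fact pVM : {morph pV : x y / x * y}.
Proof. by move=> x y; exact: val_inj. Qed.
HB.instance Definition _ :=
  isMultiplicative.Build (OmegaS A) (Omega V A) pV pVM.

Lemma pV_continuous : continuous pV.
Proof.
apply: continuous_comp_initial => x.
apply: (@continuous_comp _ _ _ (val : OmegaS A -> _) restrict_valuations).
  exact: val_Omega_continuous.
exact: restrict_valuations_continuous.
Qed.

Lemma pV_gen a : pV (Omega_gen _ a) = Omega_gen _ a.
Proof. exact: val_inj. Qed.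

End Projection.

(* A new identity [None] is adjoined even when S already has an identity. *)
Definition adjoin1 (S : Type) : Type := option S.

Section Adjoin1.
Variable S : semigroupType.

Definition adjoin1_mul (x y : adjoin1 S) : adjoin1 S :=
  match x, y with
  | Some s, Some t => Some (s * t)
  | None, _ => y
  | _, None => x
  end.

HB.instance Definition _ := Choice.on (adjoin1 S).

Fact adjoin1_mulA : associative adjoin1_mul.
Proof. by move=> [x|] [y|] [z|] //=; rewrite mulgA. Qed.
Fact adjoin1_mul1 : left_id None adjoin1_mul.
Proof. by case. Qed.
Fact adjoin1_mulr1 : right_id None adjoin1_mul.
Proof. by case. Qed.
HB.instance Definition _ :=
  isMonoid.Build (adjoin1 S) adjoin1_mulA adjoin1_mul1 adjoin1_mulr1.
End Adjoin1.

Definition extend1 (S T : Type) (f : S -> T) : adjoin1 S -> adjoin1 T := omap f.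

Definition models_eq (V : semigroup_class) (A : Type)
    (u v : adjoin1 (OmegaS A)) : Prop :=
  extend1 (@pV V A) u = extend1 (@pV V A) v.

Definition Omega_kappa (A : Type) : set (OmegaS A) :=
  smallest (fun B => subsemigroup B /\
                     forall s t, B s -> is_omega_minus1 s t -> B t)
    (range (@Omega_gen all_semigroups A)).

Definition Omega_kappa1 (A : Type) : set (adjoin1 (OmegaS A)) :=
  [set u | forall s, u = Some s -> Omega_kappa s].

(* A pair (u, v) of words stands for the equation u = v. *)
Notation equation X := (seq X * seq X)%type.

Definition word_value (X : Type) (M : monoidType) (eta : X -> M)
  (u : seq X) : M :=
  (\prod_(x <- u) eta x)%g.

Definition is_solution (V : semigroup_class) (X : finType) (A S : Type)
    (Sigma : seq (equation X)) (phi : X -> adjoin1 S) (delta : OmegaS A -> S)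
    (eta : X -> adjoin1 (OmegaS A)) : Prop :=
  (forall x, extend1 delta (eta x) = phi x) /\
  forall u v : seq X, (u, v) \in Sigma ->
    models_eq V (word_value eta u) (word_value eta v).

Definition is_kappa_solution (V : semigroup_class) (X : finType) (A S : Type)
    (Sigma : seq (equation X)) (phi : X -> adjoin1 S) (delta : OmegaS A -> S)
    (eta : X -> adjoin1 (OmegaS A)) : Prop :=
  is_solution V Sigma phi delta eta /\ forall x, Omega_kappa1 (eta x).

Definition is_generator_morphism (A : Type) (S : finSemigroupType)
    (gen : A -> S) (delta : {multiplicative OmegaS A -> S}) : Prop :=
  continuous (delta : OmegaS A -> discrete_topology S) /\
  forall a, delta (Omega_gen _ a) = gen a.

Definition kappa_reducible (V : semigroup_class) (X : finType)
    (Sigma : seq (equation X)) : Prop :=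
  forall (A : finType) (S : finSemigroupType) (gen : A -> S),
    subsemigroup_gen (range gen) = setT ->
  forall delta : {multiplicative OmegaS A -> S},
    is_generator_morphism gen delta ->
  forall phi : X -> adjoin1 S,
    (exists eta, is_solution V Sigma phi delta eta) ->
    exists eta, is_kappa_solution V Sigma phi delta eta.

(* The system x_0 = x_1 = ... = x_(m-1), as the m-1 equations between
   consecutive variables. *)
Definition pointlike_system (m : nat) : seq (equation 'I_m) :=
  [seq ([:: e.1], [:: e.2]) | e <- zip (enum 'I_m) (behead (enum 'I_m))].

Definition pointlike_kappa_reducible (V : semigroup_class) : Prop :=
  forall m : nat, (2 <= m)%N -> kappa_reducible V (pointlike_system m).

(* Main.v *)
Require Import Defs.
From HB Require Import structures.
From mathcomp Require Import all_boot zify.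
From mathcomp Require Import boolp classical_sets functions topology.

Set Implicit Arguments.
Unset Strict Implicit.
Unset Printing Implicit Defensive.

Local Open Scope classical_set_scope.
Local Open Scope group_scope.

(** Let pi_1, ..., pi_m be pseudowords over A that are equal over V*D, and let
    delta map A to a finite semigroup S.  The plan is to read the pi_i with a
    finite automaton whose state after w is the suffix of w of length at most
    K = |S| + 1.  The transitions form a finite alphabet B of pairs (q, a), and
    reading pi_i produces a pseudoword rho_i over B.

    The state set of this automaton is acted upon by a definite semigroup, the
    semigroup of nonempty words of length at most K.  Hence a valuation of B in
    a member U of V gives rise to a valuation of A in the wreath product of U by
    that semigroup, which lies in V*D: equality of the pi_i over V*D gives
    equality of the rho_i over V, and the final states agree
    ([reading_eq], [window_eq]).

    Each transition b is replaced by a kappa-word [edge] b over A, so that a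
    path spells out a pseudoword which nearly has the value of the word read.
    By the pigeonhole principle every word of length K has a factor p with a
    nonempty suffix y such that delta(p) delta(y) = delta(p), so y^omega may be
    inserted after p at no cost.  The automaton keeps a mark at the end of such
    a factor of its window, the one that starts furthest to the right.  The
    letters after the mark are withheld; when the mark jumps to the end of the
    window, the withheld letters are emitted, followed by the new y^omega; while
    the mark stays, y^omega is emitted again.  Since the mark never moves to the
    left ([window_pending]), the value emitted so far, times the value of the
    withheld letters, is the value of the input ([reading_value]).

    Conversely, suppose that r and r' are paths from the empty window to the
    same state and that V satisfies r = r'.  Then V*D satisfies the equality of
    their images under [edge] ([subst_edge_eq]).  Indeed, in a semidirect product of U by R
    with R in D, the R-component of what has been emitted depends only on the
    state reached: before the first mark this state is the word emitted, and
    afterwards the word emitted ends in an idempotent, while idempotents of R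
    are right zeros.  The U-component of the image of a path is therefore a
    homomorphic image of the path itself, with values in U, a member of V.

    It remains to apply the hypothesis on V to the rho_i, with a finite
    semigroup [paths] that records the endpoints of a path and the value that
    it emits.  The kappa-words obtained over B are again paths with the right
    endpoints; substituting [edge] and appending the withheld letters gives the
    solution over A. *)

(** * Closed subsemigroups of Omega *)

Lemma closed_preimage (X Y : topologicalType) (f : X -> Y) (C : set Y) :
  continuous f -> closed C -> closed (f @^-1` C).
Proof. by move=> cf cC; apply: preimage_closed cC => x _; exact: cf. Qed.

Lemma closed_discrete1 (X : topologicalType) (S : choiceType)
    (f : X -> discrete_topology S) (C : set S) :
  continuous f -> closed [set x | C (f x)].
Proof.
move=> cf; apply: (@closed_preimage _ (discrete_topology S) f C cf).
exact: discrete_closed.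
Qed.

Lemma closed_discrete2 (X : topologicalType) (S T : choiceType)
    (f : X -> discrete_topology S) (g : X -> discrete_topology T)
    (C : S -> T -> Prop) :
  continuous f -> continuous g -> closed [set x | C (f x) (g x)].
Proof.
move=> cf cg; rewrite -openC openE => x /= nC.
have nf : nbhs x (f @^-1` [set f x]) by apply: cf; exact: discrete_set1.
have ng : nbhs x (g @^-1` [set g x]) by apply: cg; exact: discrete_set1.
by apply: filterS2 nf ng => y /= -> ->.
Qed.

Lemma closure_subsemigroup (S : topologicalSemigroupType) (B : set S) :
  subsemigroup B -> subsemigroup (closure B).
Proof.
move=> mB x y Bx By N /(mulg_continuous (x, y)) [[U W] /= [nU nW] sN].
have [u [Bu Uu]] := Bx _ nU; have [w [Bw Ww]] := By _ nW.
by exists (u * w); split; [exact: mB | exact: (sN (u, w))].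
Qed.

(** The closure in the ambient product of the image of B is a closed
    subsemigroup that contains the generators, hence the whole of Omega; as
    Omega has the induced topology, B is dense in it. *)
Lemma Omega_dense (V : semigroup_class) (A : Type) (B : set (Omega V A)) :
  closed B -> subsemigroup B -> (forall a, B (Omega_gen V a)) ->
  forall x, B x.
Proof.
move=> cB mB gB x.
pose C : set (valuation_product V A) := closure (val @` B).
have Cx : C (val x).
  apply: (set_valP x C); split; last first.
    move=> _ [a _ <-]; apply: subset_closure.
    by exists (Omega_gen V a); first exact: gB.
  split; first exact: closed_closure.
  apply: closure_subsemigroup => _ _ [y By <-] [z Bz <-].
  by exists (y * z); first exact: mB.
suff: closure B x by rewrite -(iffLR (closure_id B) cB).
move=> N [_ [[W oW <-] Wx] sN].
have [_ [[y By <-] Wy]] := Cx W (open_nbhs_nbhs (conj oW Wx)).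
by exists y; split=> //; exact: sN.
Qed.

Lemma coord_continuous (V : semigroup_class) (A : Type) (i : valuation V A) :
  continuous (fun x : Omega V A => val x i : discrete_topology (val_cod i)).
Proof.
move=> x; pose pr (v : valuation_product V A) : discrete_topology (val_cod i) :=
  v i.
apply: (@continuous_comp _ _ _ (val : Omega V A -> _) pr).
  exact: val_Omega_continuous.
exact: (@prod_topology_proj (valuation V A)
  (fun j => discrete_topology (val_cod j))).
Qed.

Lemma discrete_comp_continuous (X : topologicalType) (S T : choiceType)
    (f : X -> discrete_topology S) (h : S -> T) :
  continuous f -> continuous (fun x => h (f x) : discrete_topology T).
Proof.
move=> cf x; apply: (@continuous_comp _ (discrete_topology S)
  (discrete_topology T) f h); first exact: cf.
by move=> U /principal_filterP Us; apply/principal_filterP.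
Qed.

(** * Evaluation of pseudowords in finite semigroups *)

Section OrdCopy.
Variable S : finSemigroupType.

Definition ord_copy_mul (i j : 'I_#|S|) : 'I_#|S| :=
  enum_rank (enum_val i * enum_val j).

Fact ord_copy_mulA : associative ord_copy_mul.
Proof. by move=> i j k; rewrite /ord_copy_mul !enum_rankK mulgA. Qed.

(** Coordinates of a pseudoword are indexed by valuations in ordinals only;
    a copy on an ordinal gives access to the other finite semigroups. *)
Definition ord_copy : ord_semigroup := OrdSemigroup ord_copy_mulA.

Definition of_copy (i : ord_copy) : S := enum_val i.
Definition to_copy (s : S) : ord_copy := enum_rank s.

Fact of_copyM : {morph of_copy : i j / i * j}.
Proof. by move=> i j; exact: enum_rankK. Qed.
HB.instance Definition _ := isMultiplicative.Build ord_copy S of_copy of_copyM.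

Lemma to_copyK : cancel to_copy of_copy. Proof. exact: enum_rankK. Qed.
Lemma of_copyK : cancel of_copy to_copy. Proof. exact: enum_valK. Qed.

End OrdCopy.

Lemma ord_copy_in (V : semigroup_class) (S : finSemigroupType) :
  pseudovariety V -> V S -> V (ord_copy S).
Proof.
move=> pvV; exact: (pv_sub pvV (f := @of_copy S) (can_inj (@of_copyK S))).
Qed.

Section Evaluation.
Variables (A : Type) (S : finSemigroupType) (f : A -> S).

(** The continuous homomorphism that extends f, for a finite semigroup S of
    any carrier. *)
Definition ev (x : OmegaS A) : S := of_copy
  (val x (@Valuation all_semigroups A (ord_copy S) Logic.I
    (fun a => to_copy (f a)))).

Fact evM : {morph ev : x y / x * y}.
Proof. by move=> x y; exact: of_copyM. Qed.
HB.instance Definition _ := isMultiplicative.Build (OmegaS A) S ev evM.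

Lemma ev_gen a : ev (Omega_gen _ a) = f a.
Proof. exact: to_copyK. Qed.

Lemma ev_continuous : continuous (ev : OmegaS A -> discrete_topology S).
Proof. exact: discrete_comp_continuous (@coord_continuous _ _ _). Qed.

(** The equalizer of two continuous homomorphisms to a discrete semigroup is a
    closed subsemigroup. *)
Lemma ev_unique (h : OmegaS A -> S) :
  continuous (h : _ -> discrete_topology S) -> {morph h : x y / x * y} ->
  (forall a, h (Omega_gen _ a) = f a) -> h =1 ev.
Proof.
move=> ch hM hg x; apply: (Omega_dense (B := [set x | h x = ev x])).
- exact: (@closed_discrete2 (OmegaS A) S S h ev (fun s t => s = t) ch ev_continuous).
- by move=> y z /= hy hz; rewrite hM hy hz evM.
- by move=> a /=; rewrite hg ev_gen.
Qed.

Lemma ev_mem (C : set S) :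
  subsemigroup C -> (forall a, C (f a)) -> forall x, C (ev x).
Proof.
move=> mC gC x; apply: (Omega_dense (B := [set x | C (ev x)])) => [|y z /= Cy Cz|a].
- exact: closed_discrete1 ev_continuous.
- by rewrite evM; exact: mC.
- by rewrite /= ev_gen.
Qed.

(** In a given finite semigroup, a pseudoword cannot be distinguished from a
    suitable word. *)
Lemma ev_word x :
  exists w, Some (ev x) = word_value (fun a => Some (f a) : adjoin1 S) w.
Proof.
apply: (@ev_mem [set s | exists w, Some s =
    word_value (fun a => Some (f a) : adjoin1 S) w]) => [s t [u us] [v vt]|a].
  exists (u ++ v); rewrite /word_value big_cat /=.
  by rewrite -[LHS]/((Some s : adjoin1 S) * Some t) us vt.
by exists [:: a]; rewrite /word_value big_seq1.
Qed.

End Evaluation.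

Lemma ev_comp (A : Type) (S T : finSemigroupType) (h : S -> T)
    (f : A -> S) (x : OmegaS A) :
  {morph h : s t / s * t} -> h (ev f x) = ev (fun a => h (f a)) x.
Proof.
move=> hM.
apply: (@ev_unique A T _ (fun x => h (ev f x))) => {x} [|x y|a].
- exact: discrete_comp_continuous (@ev_continuous _ _ f).
- by rewrite evM hM.
- by rewrite ev_gen.
Qed.

Lemma ev_coord (A : Type) (x : OmegaS A) (i : valuation all_semigroups A) :
  val x i = ev (@val_fun _ _ i) x.
Proof.
apply: (@ev_unique A (val_cod i) _ (fun x : OmegaS A => val x i)) => //.
exact: coord_continuous.
Qed.

(** Turns equality over V into a statement about all finite members of V; a
    pseudovariety is closed under passing to the copy on an ordinal. *)
Lemma pV_eqP (V : semigroup_class) (A : Type) (x y : OmegaS A) :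
  pseudovariety V -> pV V x = pV V y <->
  (forall (S : finSemigroupType) (f : A -> S), V S -> ev f x = ev f y).
Proof.
move=> pvV; split=> [eqV S f VS|exy].
  have := congr1 (fun z : Omega V A => val z (@Valuation V A _
    (ord_copy_in pvV VS) (fun a => to_copy (f a)))) eqV.
  exact: (congr1 (@of_copy S)).
apply/val_inj/functional_extensionality_dep => i /=.
by rewrite /restrict_valuations !ev_coord; exact: (exy _ _ (val_codP i)).
Qed.

(** * Powers in finite semigroups *)

Section SemigroupPowers.
Variable S : semigroupType.
Implicit Types s e t : S.

(** The exponent is shifted, [spow s n] being s^(n+1), as there is no
    identity to serve as s^0. *)
Definition spow s n : S := iter n (fun t => s * t) s.

Lemma spowM s m n : spow s m * spow s n = spow s (m + n).+1.
Proof.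
elim: m => [|m IH] /=; first by rewrite add0n.
by rewrite -mulgA IH.
Qed.

Lemma spowMl s n : s * spow s n = spow s n.+1. Proof. by []. Qed.

Lemma spowMr s n : spow s n * s = spow s n.+1.
Proof. by rewrite -[X in _ * X]/(spow s 0) spowM addn0. Qed.

Lemma spow_idem e n : e * e = e -> spow e n = e.
Proof. by move=> ee; elim: n => //= n ->. Qed.

Lemma spow_mem (C : set S) s n : subsemigroup C -> C s -> C (spow s n).
Proof. by move=> mC Cs; elim: n => //= n IH; exact: mC. Qed.

(** The group of units of the local monoid eSe. *)
Definition local_unit e s := [/\ e * s = s, s * e = s &
  exists t, [/\ e * t = t, t * e = t, s * t = e & t * s = e]].

Lemma local_unit_mul e s t : local_unit e s -> local_unit e t ->
  local_unit e (s * t).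
Proof.
move=> [es se [s' [es' s'e ss' s's]]] [et te [t' [et' t'e tt' t't]]]; split.
- by rewrite mulgA es.
- by rewrite -mulgA te.
exists (t' * s'); split.
- by rewrite mulgA et'.
- by rewrite -mulgA s'e.
- by rewrite -mulgA (mulgA t) tt' es' ss'.
- by rewrite -mulgA (mulgA s') s's et t't.
Qed.

End SemigroupPowers.

Lemma spow_morph (S T : semigroupType) (h : S -> T) s n :
  {morph h : x y / x * y} -> h (spow s n) = spow (h s) n.
Proof. by move=> hM; elim: n => //= n IH; rewrite hM IH. Qed.

Section FinitePowers.
Variable S : finSemigroupType.
Implicit Types s e t : S.

(** Two of the first |S|+1 powers coincide.  Both the index and the period are
    thus at most |S|, so that |S|! is a multiple of the period. *)
Lemma spow_period s : exists p, [/\ (0 < p)%N, (p <= #|S|)%N &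
  forall k, (#|S| <= k.+1)%N -> spow s (k + p) = spow s k].
Proof.
have : ~~ injectiveb (fun i : 'I_#|S|.+1 => spow s i).
  apply/negP => /injectiveP inj.
  by have := leq_card _ inj; rewrite card_ord ltnn.
case/injectivePn=> i [j neij eqij].
wlog lij : i j neij eqij / (i < j)%N.
  move=> H; case: (ltngtP i j) => [/H|/H|/val_inj eij]; first exact.
    by apply; rewrite 1?eq_sym.
  by rewrite eij eqxx in neij.
exists (j - i)%N; split; [lia | by have := ltn_ord j; lia | ].
move=> k hk; have {hk} hk : (i <= k)%N by have := ltn_ord j; lia.
case: (ltngtP i k) => [lik|ltk|eik].
- have -> : (k + (j - i))%N = ((k - i).-1 + j).+1 by lia.
  rewrite -spowM -eqij spowM; congr (spow _ _); lia.
- by lia.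
- by rewrite -eik subnKC ?eqij // ltnW.
Qed.

Lemma spow_add_multiple s n c k : (#|S| <= n)%N -> (#|S| <= k.+1)%N ->
  spow s (k + c * n`!) = spow s k.
Proof.
move=> hn hk; have [p [p0 lep per]] := spow_period s.
have /dvdnP [d ->] : (p %| n`!)%N by apply: dvdn_fact; rewrite p0 (leq_trans lep).
rewrite mulnA; elim: (c * d)%N => [|m IH]; first by rewrite addn0.
have -> : (k + m.+1 * p)%N = (k + m * p + p)%N by rewrite mulSn; lia.
by rewrite per //; apply: leq_trans hk _; rewrite ltnS leq_addr.
Qed.

(** s^(2|S|!) and s^(2|S|!-1).  The factor 2 keeps the exponent of the second
    one beyond the index of s, even when |S| is 1. *)
Definition fin_omega s : S := spow s (2 * (#|S|)`!).-1.
Definition fin_omega1 s : S := spow s (2 * (#|S|)`! - 2).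

Lemma leq_card_fact s : (0 < #|S| <= (#|S|)`!)%N.
Proof.
have S0 : (0 < #|S|)%N by apply/card_gt0P; exists s.
by rewrite S0 -[X in (X <= _)%N]prednK // -[X in (_ <= X`!)%N]prednK //
  factS leq_pmulr ?fact_gt0.
Qed.

(** The sequence s^(2n!-1) is eventually constant; this makes a coordinatewise
    limit out of the (omega-1)-power. *)
Lemma fin_omega1_stable s n : (#|S| <= n)%N ->
  spow s (2 * n`! - 2) = fin_omega1 s.
Proof.
move=> len; have /dvdnP [c ec] : ((#|S|)`! %| n`!)%N.
  by rewrite -(ffact_fact (leq_subr #|S| n)) subKn // dvdn_mull.
have c0 : (0 < c)%N by have := fact_gt0 n; rewrite ec; case: (c).
rewrite /fin_omega1 -[RHS](@spow_add_multiple s #|S| (2 * c.-1)); first last.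
- by have := leq_card_fact s; lia.
- by [].
congr (spow _ _); rewrite ec; have := leq_card_fact s.
by case: c c0 {ec} => // c _ /=; nia.
Qed.

Lemma fin_omega_idem s : fin_omega s * fin_omega s = fin_omega s.
Proof.
rewrite /fin_omega spowM -[RHS](@spow_add_multiple s #|S| 2).
- by congr (spow _ _); have := leq_card_fact s; lia.
- by [].
- by have := leq_card_fact s; lia.
Qed.

Lemma mul_fin_omega1 s : s * fin_omega1 s = fin_omega s.
Proof. by rewrite /fin_omega1 spowMl; congr (spow _ _); have := fact_gt0 #|S|; lia. Qed.

Lemma fin_omega1_mul s : fin_omega1 s * s = fin_omega s.
Proof. by rewrite /fin_omega1 spowMr; congr (spow _ _); have := fact_gt0 #|S|; lia. Qed.

Lemma fin_omegaK s : fin_omega s * fin_omega1 s = fin_omega1 s.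
Proof.
rewrite /fin_omega spowM -[RHS](@spow_add_multiple s #|S| 2).
- by congr (spow _ _); have := fact_gt0 #|S|; lia.
- by [].
- by have := leq_card_fact s; lia.
Qed.

Lemma fin_omega1K s : fin_omega1 s * fin_omega s = fin_omega1 s.
Proof.
by rewrite -{1}mul_fin_omega1 mulgA fin_omega1_mul fin_omegaK.
Qed.

Lemma fin_omega_unique s e :
  (exists n, e = spow s n) -> e * e = e -> e = fin_omega s.
Proof.
move=> [n en] ee.
have spowX m k : spow (spow s m) k = spow s (m.+1 * k.+1).-1.
  elim: k => [|k IH]; first by rewrite muln1.
  by rewrite -spowMl IH spowM; congr (spow _ _); nia.
rewrite -(spow_idem (2 * (#|S|)`!).-1 ee) -[RHS](spow_idem n (fin_omega_idem s)).
rewrite en !spowX; congr (spow _ _.-1).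
by rewrite !prednK ?muln_gt0 ?fact_gt0 // mulnC.
Qed.

Lemma local_unit_omega e s : local_unit e s -> e * e = e -> fin_omega s = e.
Proof.
move=> [es se [t [et te st ts]]] ee.
have powK n : spow t n * spow s n = e /\ e * spow s n = spow s n.
  elim: n => [//|n [IH1 IH2]]; split; last by rewrite /= mulgA es.
  rewrite -spowMr /= -mulgA (mulgA t) ts IH2 //.
have [tsn esn] := powK (2 * (#|S|)`!).-1.
have ff := fin_omega_idem s; rewrite /fin_omega in ff *.
by rewrite -esn -{1}tsn -mulgA ff tsn.
Qed.

Lemma local_unit_fin_omega s : local_unit (fin_omega s) (fin_omega s * s).
Proof.
have com : s * fin_omega s = fin_omega s * s by rewrite /fin_omega spowMl spowMr.
split; first by rewrite mulgA fin_omega_idem.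
  by rewrite -mulgA com mulgA fin_omega_idem.
exists (fin_omega1 s); split; [exact: fin_omegaK | exact: fin_omega1K | | ].
  by rewrite -mulgA mul_fin_omega1 fin_omega_idem.
by rewrite mulgA fin_omega1K fin_omega1_mul.
Qed.

End FinitePowers.

(** * The implicit operations of kappa on pseudowords *)

Section OmegaPowers.
Variable A : Type.
Notation P := (valuation_product all_semigroups A).
Implicit Types x s t e : OmegaS A.

Definition prod_omega1 (v : P) : P := fun i => fin_omega1 (v i).

(** The sequence v^(2n!-1) converges to [prod_omega1 v], because each of its
    coordinates is eventually constant. *)
Lemma prod_omega1_mem (C : set P) v :
  closed C -> subsemigroup C -> C v -> C (prod_omega1 v).
Proof.
move=> cC mC Cv.
apply: (@closed_cvg nat P \oo _ (fun n => spow v (2 * n`! - 2)) C cC).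
  by apply: filterE => n; exact: spow_mem.
apply/cvg_sup => i U [W [[T oT <-] Tv] sWU].
apply: filterS sWU _; exists #|val_cod i| => // n /= len.
rewrite (@spow_morph P (val_cod i) (fun v => v i)) //.
by rewrite fin_omega1_stable.
Qed.

Fact omega1_subproof x : prod_omega1 (val x)
  \in closed_subsemigroup_gen (range (@valuation_gen all_semigroups A)).
Proof.
apply/mem_set => C [[cC mC] gC]; apply: prod_omega1_mem => //.
exact: (set_valP x C).
Qed.

Definition omega1 x : OmegaS A := SigSub (omega1_subproof x).
Definition omega x : OmegaS A := x * omega1 x.

Lemma val_omega x i : val (omega x) i = fin_omega (val x i).
Proof. exact: mul_fin_omega1. Qed.

Lemma Omega_eqP x y : (forall i, val x i = val y i) -> x = y.
Proof. by move=> exy; apply/val_inj/functional_extensionality_dep. Qed.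

Lemma omega_idem x : omega x * omega x = omega x.
Proof.
by apply: Omega_eqP => i; rewrite -[LHS]/(val (omega x) i * val (omega x) i)
  !val_omega fin_omega_idem.
Qed.

Lemma omega1_closed_gen x (C : set (OmegaS A)) :
  closed C -> subsemigroup C -> C x -> C (omega1 x).
Proof.
move=> cC mC Cx; pose K := closure (val @` C : set P).
have : K (val (omega1 x)).
  apply: (@prod_omega1_mem K (val x)); first exact: closed_closure.
    apply: closure_subsemigroup => _ _ [y Cy <-] [z Cz <-].
    by exists (y * z); first exact: mC.
  by apply: subset_closure; exists x.
move=> Kx; suff: closure C (omega1 x) by rewrite -(iffLR (closure_id C) cC).
move=> N [_ [[W oW <-] Wx] sN].
have [_ [[y Cy <-] Wy]] := Kx W (open_nbhs_nbhs (conj oW Wx)).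
by exists y; split=> //; exact: sN.
Qed.

Lemma is_omegaP s e : is_omega s e <-> e = omega s.
Proof.
split=> [[ge ee]|->]; last first.
  split; last exact: omega_idem.
  move=> C [[cC mC] Cs]; have {}Cs := Cs s erefl.
  by apply: (mC) => //; apply: (@omega1_closed_gen s C cC mC Cs).
apply: Omega_eqP => i; rewrite val_omega; apply: fin_omega_unique.
  have := ge [set y : OmegaS A | exists n, val y i = spow (val s i) n].
  apply.
  split; last by move=> _ ->; exists 0%N.
  split.
    exact: (closed_discrete1 (C := fun z => exists n, z = spow (val s i) n)
      (@coord_continuous _ _ i)).
  move=> y z [m ym] [n zn]; exists (m + n).+1.
  by rewrite -spowM -ym -zn.
exact: (congr1 (fun y : OmegaS A => val y i) ee).
Qed.

(** The maximal subgroup at e, described coordinate by coordinate, which makes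
    it visibly closed. *)
Definition unit_group e : set (OmegaS A) :=
  [set x | forall i, local_unit (val e i) (val x i)].

Lemma unit_group_maximal e : e * e = e ->
  is_maximal_closed_subgroup_at e (unit_group e).
Proof.
move=> ee; have eei i : val e i * val e i = val e i.
  exact: (congr1 (fun y : OmegaS A => val y i) ee).
split; last first.
  move=> H [_ _ He He1 HV] x Hx i; have [ex xe] := He1 _ Hx.
  have [y Hy [xy yx]] := HV _ Hx; have [ey ye] := He1 _ Hy.
  pose p (z : OmegaS A) := val z i.
  split; [exact: (congr1 p ex) | exact: (congr1 p xe) | ].
  by exists (val y i); split;
    [exact: (congr1 p ey) | exact: (congr1 p ye) | exact: (congr1 p xy)
    | exact: (congr1 p yx)].
split.
- have -> : unit_group e =
      \bigcap_(i in [set: valuation all_semigroups A])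
        [set x | local_unit (val e i) (val x i)].
    by apply/seteqP; split=> x /= ux i; [move=> _|]; exact: ux.
  apply: closed_bigI => i _.
  exact: (closed_discrete1 (C := local_unit (val e i))
    (@coord_continuous _ _ i)).
- by move=> x y ux uy i; exact: local_unit_mul.
- by move=> i; split; rewrite ?eei //; exists (val e i); rewrite !eei.
- by move=> x ux; split; apply: Omega_eqP => i; case: (ux i).
move=> x ux.
have ex i : fin_omega (val x i) = val e i.
  exact: (local_unit_omega (ux i) (eei i)).
exists (omega1 x).
  move=> i; rewrite -ex /=; have [e1 e2 _] := ux i.
  split; [exact: fin_omegaK | exact: fin_omega1K | ].
  exists (val x i); rewrite -ex in e1 e2; split=> //.
    exact: fin_omega1_mul.
  exact: mul_fin_omega1.
split; apply: Omega_eqP => i; rewrite -ex.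
  exact: mul_fin_omega1.
exact: fin_omega1_mul.
Qed.

(** Removes topology from the (omega-1)-power: it becomes a total operation,
    computed in each coordinate as a power.  Its compatibility with
    substitutions is then immediate. *)
Lemma is_omega_minus1P s t : is_omega_minus1 s t <-> t = omega1 s.
Proof.
have eK := omega_idem s.
have omE i : val (omega s) i = fin_omega (val s i) by exact: val_omega.
have es1 : omega s * omega1 s = omega1 s.
  apply: Omega_eqP => i; rewrite -[LHS]/(val (omega s) i * val (omega1 s) i).
  by rewrite omE fin_omegaK.
have s1s : omega1 s * s = omega s.
  by apply: Omega_eqP => i; rewrite omE -fin_omega1_mul.
have s1e : omega1 s * omega s = omega1 s by rewrite {1}/omega mulgA s1s.
have ss1 : (omega s * s) * omega1 s = omega s.
  by rewrite -mulgA -[s * omega1 s]/(omega s).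
have s1es : omega1 s * (omega s * s) = omega s by rewrite mulgA s1e.
split=> [[e [G [/is_omegaP -> [[_ _ _ Ge _] _] Ges Gt [st ts]]]]|->].
  by have [_ te] := Ge _ Gt; rewrite -te -{1}ss1 mulgA ts es1.
have ees : omega s * (omega s * s) = omega s * s by rewrite mulgA eK.
have ese : (omega s * s) * omega s = omega s * s.
  by rewrite -mulgA -{2}s1s [s * _]mulgA -[s * omega1 s]/(omega s) mulgA eK.
exists (omega s), (unit_group (omega s)); split=> //.
- exact/is_omegaP.
- exact: unit_group_maximal.
- move=> i; rewrite -[val (omega s * s) i]/(val (omega s) i * val s i) omE.
  exact: local_unit_fin_omega.
have coord (x y : OmegaS A) i : x = y -> val x i = val y i by move=> ->.
move=> i; split; [exact: (coord _ _ i es1) | exact: (coord _ _ i s1e) | ].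
exists (val (omega s * s) i); split.
- exact: (coord _ _ i ees).
- exact: (coord _ _ i ese).
- exact: (coord _ _ i s1es).
- exact: (coord _ _ i ss1).
Qed.

End OmegaPowers.

Section Kappa.
Variable A : Type.
Implicit Types x y : OmegaS A.

Lemma kappa_gen a : Omega_kappa (Omega_gen all_semigroups a : OmegaS A).
Proof. by move=> B [_ gB]; apply: gB; exists a. Qed.

Lemma kappa_mul x y : Omega_kappa x -> Omega_kappa y -> Omega_kappa (x * y).
Proof.
move=> kx ky B BP; have [[mB _] _] := BP.
by apply: mB; [exact: kx | exact: ky].
Qed.

Lemma kappa_omega1 x : Omega_kappa x -> Omega_kappa (omega1 x).
Proof.
move=> kx B BP; have [[_ oB] _] := BP.
by apply: (oB x); [exact: kx | exact/is_omega_minus1P].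
Qed.

Lemma kappa_omega x : Omega_kappa x -> Omega_kappa (omega x).
Proof. by move=> kx; apply: kappa_mul => //; exact: kappa_omega1. Qed.

End Kappa.

Section Substitution.
Variables (A B : Type) (th : B -> OmegaS A).

(** The coordinate of the image at a valuation i of A is the coordinate of the
    argument at the valuation of B obtained by evaluating the images of the
    letters at i. *)
Definition subst_prod (v : valuation_product all_semigroups B) :
    valuation_product all_semigroups A :=
  fun i => v (@Valuation all_semigroups B (val_cod i) Logic.I
    (fun b => val (th b) i)).

Fact subst_subproof (x : OmegaS B) : subst_prod (val x)
  \in closed_subsemigroup_gen (range (@valuation_gen all_semigroups A)).
Proof.
apply/mem_set => C CP; have [[cC mC] _] := CP.
apply: (set_valP x (subst_prod @^-1` C)); split; last first.
  by move=> _ [b _ <-]; exact: (set_valP (th b) C CP).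
split; last by move=> y z Cy Cz; exact: mC Cy Cz.
apply: closed_preimage cC; apply: prod_topology_continuous => i.
exact: (@prod_topology_proj (valuation all_semigroups B)
  (fun j => discrete_topology (val_cod j))
  (@Valuation all_semigroups B (val_cod i) Logic.I (fun b => val (th b) i))).
Qed.

Definition subst (x : OmegaS B) : OmegaS A := SigSub (subst_subproof x).

Lemma subst_mul : {morph subst : x y / x * y}.
Proof. by move=> x y; exact: val_inj. Qed.

Lemma subst_gen b : subst (Omega_gen _ b) = th b.
Proof. by apply: Omega_eqP. Qed.

Lemma subst_omega1 x : subst (omega1 x) = omega1 (subst x).
Proof. by apply: Omega_eqP. Qed.

Lemma ev_subst (S : finSemigroupType) (f : A -> S) x :
  ev f (subst x) = ev (fun b => ev f (th b)) x.
Proof.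
transitivity (of_copy (ev (fun b => val (th b) (@Valuation all_semigroups A
    (ord_copy S) Logic.I (fun a => to_copy (f a)))) x)).
  rewrite -(ev_coord x (@Valuation all_semigroups B (ord_copy S) Logic.I
    (fun b => val (th b) (@Valuation all_semigroups A (ord_copy S) Logic.I
      (fun a => to_copy (f a)))))).
  by [].
by rewrite ev_comp //; exact: of_copyM.
Qed.

Lemma kappa_subst x :
  (forall b, Omega_kappa (th b)) -> Omega_kappa x -> Omega_kappa (subst x).
Proof.
move=> kth kx; apply: (kx [set y | Omega_kappa (subst y)]); split; last first.
  by move=> _ [b _ <-]; rewrite /= subst_gen.
split=> [y z ky kz|s t ks /is_omega_minus1P ->].
  by rewrite /= subst_mul; exact: kappa_mul.
by rewrite /= subst_omega1; exact: kappa_omega1.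
Qed.

End Substitution.

(** * Reading pseudowords with an automaton *)

HB.instance Definition _ (Q : finType) (S : finSemigroupType) :=
  Semigroup.on {ffun Q -> S}.

Section FiniteClasses.
Variables (V : semigroup_class) (pvV : pseudovariety V).

(** A finite power is an iterated binary product. *)
Lemma pv_ffun (Q : finType) (S : finSemigroupType) :
  V S -> V {ffun Q -> S}.
Proof.
move=> VS.
have VI n : V {ffun 'I_n -> S}.
  elim: n => [|n IH].
    apply: (pv_trivial pvV).
    by rewrite card_ffun card_ord expn0.
  pose h (f : {ffun 'I_n.+1 -> S}) : S * {ffun 'I_n -> S} :=
    (f ord0, [ffun i => f (lift ord0 i)]).
  have hM : {morph h : f g / f * g}.
    move=> f g; congr (_, _); first by rewrite ffunE.
    by apply/ffunP => i; rewrite !ffunE.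
  pose H := isMultiplicative.Build _ _ h hM.
  pose hh : {multiplicative {ffun 'I_n.+1 -> S} -> (S * {ffun 'I_n -> S})%type} :=
    HB.pack h H.
  apply: (pv_sub pvV (f := hh)); last exact: (pv_prod pvV).
  move=> f g [e0 /ffunP e1]; apply/ffunP => i.
  case: (unliftP ord0 i) => [j ->|-> //].
  by have := e1 j; rewrite !ffunE.
pose h (f : {ffun Q -> S}) : {ffun 'I_#|Q| -> S} := [ffun i => f (enum_val i)].
have hM : {morph h : f g / f * g}.
  by move=> f g; apply/ffunP => i; rewrite !ffunE.
pose H := isMultiplicative.Build _ _ h hM.
pose hh : {multiplicative {ffun Q -> S} -> {ffun 'I_#|Q| -> S}} := HB.pack h H.
apply: (pv_sub pvV (f := hh)); last exact: VI.
move=> f g /ffunP e; apply/ffunP => q.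
by have := e (enum_rank q); rewrite !ffunE enum_rankK.
Qed.

End FiniteClasses.

Section Wreath.
Variables (Q : finType) (T : finSemigroupType) (qact : Q -> T -> Q).
Hypothesis qactM : forall q t t', qact q (t * t') = qact (qact q t) t'.

Section Product.
Variable S : finSemigroupType.

Definition shift (t : T) (f : {ffun Q -> S}) : {ffun Q -> S} :=
  [ffun q => f (qact q t)].

Fact shift_action : left_action shift.
Proof.
split=> [t t' f|t f g]; apply/ffunP => q; rewrite !ffunE //.
by rewrite qactM.
Qed.

(** The first component of an element is a function of the state from which
    reading starts; the second component moves this state. *)
Definition wreath : finSemigroupType := semidirect_of shift_action.

Lemma wreathM (x y : wreath) (q : Q) :
  (x * y).1 q = x.1 q * y.1 (qact q x.2).
Proof. by rewrite ffunE /= ffunE. Qed.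

End Product.

Lemma wreath_in (V W : semigroup_class) (S : finSemigroupType) :
  pseudovariety V -> V S -> W T -> semidirect_pv V W (wreath S).
Proof.
move=> pvV VS WT U pvU; apply; apply: SemidirectProduct => //.
exact: pv_ffun.
Qed.

Variables (A : Type) (letter : A -> T).
Implicit Types x y : OmegaS A.

Definition read_letter (S : finSemigroupType) (g : Q * A -> S) (a : A) :
  wreath S := ([ffun q => g (q, a)], letter a).

Lemma read_letter_snd (S : finSemigroupType) (g : Q * A -> S) x :
  (ev (read_letter g) x).2 = ev letter x.
Proof. exact: (@ev_comp _ (wreath S) T snd). Qed.

(** The word of transitions made from q is determined by its values under all
    valuations of transitions, and those are values of x in wreath products. *)
Definition read_prod (q : Q) x : valuation_product all_semigroups (Q * A) :=
  fun i => (ev (read_letter (@val_fun _ _ i)) x).1 q.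

Lemma read_prodM q x y :
  read_prod q (x * y) = read_prod q x * read_prod (qact q (ev letter x)) y.
Proof.
apply: functional_extensionality_dep => i.
by rewrite /read_prod evM wreathM read_letter_snd.
Qed.

(** The pseudowords all of whose readings belong to a given closed
    subsemigroup form a closed subsemigroup, by [read_prodM]. *)
Fact read_subproof (q : Q) x : read_prod q x
  \in closed_subsemigroup_gen (range (@valuation_gen all_semigroups (Q * A))).
Proof.
apply/mem_set => C [[cC mC] gC]; move: q.
apply: (Omega_dense (B := [set y | forall q, C (read_prod q y)])).
- have -> : [set y | forall q, C (read_prod q y)] =
      \bigcap_(q in [set: Q]) [set y | C (read_prod q y)].
    by apply/seteqP; split=> y Cy q; [move=> _|]; exact: Cy.
  apply: closed_bigI => q _; apply: closed_preimage cC.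
  apply: prod_topology_continuous => i.
  exact: (discrete_comp_continuous (S := wreath (val_cod i))
    (h := fun w => w.1 q) (@ev_continuous _ _ _)).
- by move=> y z Cy Cz q; rewrite read_prodM; exact: mC.
move=> a q; apply: gC; exists (q, a) => //.
apply: functional_extensionality_dep => i.
by rewrite /read_prod ev_gen /= ffunE.
Qed.

Definition read (q : Q) x : OmegaS (Q * A) := SigSub (read_subproof q x).

Lemma ev_read (S : finSemigroupType) (g : Q * A -> S) q x :
  ev g (read q x) = (ev (read_letter g) x).1 q.
Proof.
pose h (w : wreath (ord_copy S)) : wreath S :=
  ([ffun p => of_copy (w.1 p)], w.2).
have hM : {morph h : v w / v * w}.
  move=> v w; congr (_, _); apply/ffunP => p.
  rewrite -[RHS]/((h v * h w).1 p) wreathM ffunE wreathM of_copyM.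
  by rewrite !ffunE.
have -> : ev (read_letter g) x = h (ev (read_letter (fun b => to_copy (g b))) x).
  rewrite (ev_comp _ _ hM); congr (ev _ x); apply/funext => a.
  by congr (_, _); apply/ffunP => p; rewrite !ffunE to_copyK.
by rewrite ffunE.
Qed.

End Wreath.

(** * Reducibility without the generation hypothesis *)

Section Generated.
Variables (A : Type) (S : finSemigroupType) (f : A -> S).

(** The subsemigroup generated by the values of f; reducibility speaks of
    generated semigroups only. *)
Definition generated : Type :=
  {s : S | `[< subsemigroup_gen (range f) s >]}.
HB.instance Definition _ := Finite.on generated.

Lemma generated_mem (s : generated) : subsemigroup_gen (range f) (val s).
Proof. exact: asboolW (valP s). Qed.

Fact generated_mulP (s t : generated) :
  `[< subsemigroup_gen (range f) (val s * val t) >].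
Proof.
apply/asboolP => C CP; have [mC _] := CP.
by apply: mC; exact: (generated_mem _ CP).
Qed.

Definition generated_mul (s t : generated) : generated :=
  exist (fun s : S => `[< subsemigroup_gen (range f) s >]) _ (generated_mulP s t).

Fact generated_mulA : associative generated_mul.
Proof. by move=> s t u; apply: val_inj; exact: mulgA. Qed.
HB.instance Definition _ := isSemigroup.Build generated generated_mulA.

Fact generated_genP a : `[< subsemigroup_gen (range f) (f a) >].
Proof. by apply/asboolP => C [_ gC]; apply: gC; exists a. Qed.

Definition generated_gen (a : A) : generated :=
  exist (fun s : S => `[< subsemigroup_gen (range f) s >]) _ (generated_genP a).

Lemma generated_full : subsemigroup_gen (range generated_gen) = setT.
Proof.
apply/seteqP; split=> // s _ C [mC gC].
have : [set val t | t in C] (val s).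
  apply: (generated_mem s); split; last first.
    by move=> _ [a _ <-]; exists (generated_gen a) => //; apply: gC; exists a.
  move=> _ _ [t Ct <-] [u Cu <-]; exists (t * u) => //; exact: mC.
by move=> [t Ct /val_inj <-].
Qed.

End Generated.

(** The existence of a solution determines phi, and restricting the codomain
    of f to the subsemigroup generated by its values changes neither side. *)
Lemma reducible_ev (V : semigroup_class) (X : finType)
    (Sigma : seq (equation X)) (A : finType) (S : finSemigroupType)
    (f : A -> S) (eta : X -> adjoin1 (OmegaS A)) :
  kappa_reducible V Sigma ->
  (forall u v, (u, v) \in Sigma ->
    models_eq V (word_value eta u) (word_value eta v)) ->
  exists eta',
    is_kappa_solution V Sigma (fun x => extend1 (ev f) (eta x)) (ev f) eta'.
Proof.
move=> redV eqs.
have fE (x : OmegaS A) : ev f x = val (ev (generated_gen f) x).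
  by rewrite (@ev_comp _ (generated f) S val).
have [|//|eta' [[eta'E eqs'] keta']] := redV A (generated f) _ (generated_full f)
    (ev (generated_gen f)) _ (fun x => extend1 (ev (generated_gen f)) (eta x)).
- by split; [exact: ev_continuous | exact: ev_gen].
- by exists eta.
exists eta' => //; do 2?split => //.
move=> x; move: (eta'E x); case: (eta' x) (eta x) => [y|] [z|] //= [yz].
by rewrite !fE yz.
Qed.

(** * Marking a word at its rightmost pumpable factor *)

Section Marking.
Variables (A E : Type) (stab : seq A -> option E).
Implicit Types u s acc z : seq A.

(** Here [stab p] is the idempotent that may be inserted after p, if any.
    [first_stab acc s] finds the shortest prefix of acc ++ s, not shorter than
    acc, after which an idempotent may be inserted, and returns this idempotent
    with the rest of the word. *)
Fixpoint first_stab acc s : option (E * seq A) :=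
  if stab acc is Some e then Some (e, s)
  else if s is a :: s' then first_stab (rcons acc a) s' else None.

(** Among the factors p for which [stab p] is defined, the mark chooses the
    rightmost starting point and then the shortest length. *)
Fixpoint mark u : option (E * seq A) :=
  if u is _ :: u' then
    if mark u' is Some r then Some r else first_stab [::] u
  else None.

Definition pending u : seq A := if mark u is Some r then r.2 else [::].

Definition push (a : A) (r : E * seq A) := (r.1, rcons r.2 a).

Lemma first_stab_rcons acc s a : first_stab acc (rcons s a) =
  if first_stab acc s is Some r then Some (push a r)
  else omap (fun e => (e, [::])) (stab (acc ++ rcons s a)).
Proof.
elim: s acc => [|b s IH] acc /=; case Eacc: (stab acc) => [e|] //.
  by rewrite cats1; case: (stab (rcons acc a)).
by rewrite IH cat_rcons.
Qed.

Lemma first_stabP acc s e z : first_stab acc s = Some (e, z) ->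
  exists2 p, acc ++ s = p ++ z & stab p = Some e.
Proof.
elim: s acc => [|b s IH] acc /=; case Eacc: (stab acc) => [e'|] //.
- by case=> <- <-; exists acc.
- by case=> <- <-; exists acc.
by move=> /IH; rewrite cat_rcons.
Qed.

Lemma first_stab_prefix acc p s : stab (acc ++ p) -> first_stab acc (p ++ s).
Proof.
elim: p acc => [|b p IH] acc /=.
  by rewrite cats0; case: s => [|c s] /=; case: (stab acc).
by rewrite -cat_rcons => /IH; case: (stab acc).
Qed.

Lemma mark_spec u e z : mark u = Some (e, z) ->
  exists x p, u = x ++ p ++ z /\ stab p = Some e.
Proof.
elim: u => //= b u IH; case Em: (mark u) => [r|].
  by case=> er; have [|x [p [-> pe]]] := IH; [rewrite Em er|exists (b :: x), p].
move=> h; have [p ep sp] := @first_stabP [::] (b :: u) _ _ h.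
by exists [::], p.
Qed.

Lemma mark_prefix p s : p <> [::] -> stab p -> mark (p ++ s).
Proof.
case: p => [|b p] //= _ sp; case: (mark (p ++ s)) => //.
exact: (@first_stab_prefix [::] (b :: p)).
Qed.

Hypothesis stab_nil : stab [::] = None.

(** A factor that is better than the current choice and that appears with the
    letter a has to end with this letter, so the mark either stays or jumps to
    the end. *)
Lemma mark_rcons u a :
  mark (rcons u a) = omap (push a) (mark u) \/
  exists e, mark (rcons u a) = Some (e, [::]).
Proof.
elim: u => [|b u IH].
  rewrite /= stab_nil; case: (stab [:: a]) => [e|]; last by left.
  by right; exists e.
rewrite rcons_cons /=; case: IH => [->|[e ->]]; last by right; exists e.
case: (mark u) => [r|] /=; first by left.
rewrite stab_nil first_stab_rcons; case: (first_stab [:: b] u) => [r|]; first by left.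
by case: (stab _) => [e|]; [right; exists e|left].
Qed.

End Marking.

Section Windows.
Variable A : Type.
Implicit Types s t u v : seq A.

Definition lastn n s := drop (size s - n) s.

Lemma size_lastn n s : size (lastn n s) = minn n (size s).
Proof. by rewrite size_drop; lia. Qed.

Lemma lastn_id n s : (size s <= n)%N -> lastn n s = s.
Proof. by move=> h; rewrite /lastn (_ : _ - _ = 0)%N ?drop0 //; lia. Qed.

Lemma lastn_suffix n u v : (n <= size v)%N -> lastn n (u ++ v) = lastn n v.
Proof.
move=> h; rewrite /lastn size_cat drop_cat ltnNge (_ : (size u <= _)%N = true) //=; last by lia.
congr drop; lia.
Qed.

Lemma cat_lastn n s : exists x, s = x ++ lastn n s.
Proof. by exists (take (size s - n) s); rewrite cat_take_drop. Qed.

Lemma lastn_catl m n u v : (n <= m)%N ->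
  lastn n (lastn m u ++ v) = lastn n (u ++ v).
Proof.
move=> lenm; have [h|h] := leqP (size u) m; first by rewrite (lastn_id h).
have [x ex] := cat_lastn m u; rewrite {2}ex -catA [RHS]lastn_suffix //.
rewrite size_cat size_lastn; lia.
Qed.

Lemma lastn_catr n u v : lastn n (u ++ lastn n v) = lastn n (u ++ v).
Proof.
have [h|h] := leqP (size v) n; first by rewrite (lastn_id h).
rewrite lastn_suffix ?size_lastn; last lia.
by rewrite [RHS]lastn_suffix 1?ltnW // [LHS]lastn_id ?size_lastn ?geq_minl.
Qed.

Lemma lastn_rcons n s a : lastn n.+1 (rcons s a) = rcons (lastn n s) a.
Proof.
rewrite /lastn size_rcons subSS -!cats1 drop_cat.
case: ltnP => // h; rewrite [X in _ = X ++ _]drop_oversize //.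
by rewrite (_ : (size s - n - size s)%N = 0%N) //; lia.
Qed.

End Windows.

Section WindowStep.
Variables (A : Type) (E : Type) (stab : seq A -> option E) (k : nat).
Hypothesis stab_nil : stab [::] = None.
Hypothesis mark_long : forall u, size u = k.+1 -> mark stab u.
Variables (q : seq A) (a : A).
Hypothesis size_q : (size q <= k.+1)%N.
Notation q' := (lastn k.+1 (rcons q a)).

Lemma window_short : mark stab q' = None ->
  q' = rcons q a /\ mark stab q = None.
Proof.
move=> Nq'; have short : (size q < k.+1)%N.
  rewrite ltnNge; apply/negP => h.
  have := @mark_long q'; rewrite Nq' size_lastn size_rcons.
  by rewrite (minn_idPl _) 1?ltnW // => /(_ erefl).
have eq' : q' = rcons q a by rewrite lastn_id // size_rcons.
split=> //; have := mark_rcons stab_nil q a; rewrite -eq' Nq'.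
by case: (mark stab q) => [r|] // [|[]].
Qed.

(** Dropping the first letter of a full window may destroy the marked factor,
    but only if no factor starts later; the new mark is then at the end.  Thus
    the mark never moves to the left, and if it is not at the end it was already
    there before reading a. *)
Lemma window_pending e z : mark stab q' = Some (e, z) -> z <> [::] ->
  exists2 z', z = rcons z' a & mark stab q = Some (e, z').
Proof.
move=> mq' nz.
have mqE r : mark stab (lastn k q) = Some r -> mark stab q = Some r.
  have [h|h] := leqP (size q) k; first by rewrite lastn_id.
  have {h} sq : size q = k.+1 by apply/eqP; rewrite eqn_leq size_q.
  by case: (q) sq => //= c u [<-]; rewrite /lastn /= subSnn /= drop0 => ->.
have := mark_rcons stab_nil (lastn k q) a; rewrite -lastn_rcons mq'.
case Em: (mark stab (lastn k q)) => [[e' z']|] [] //=.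
- by case=> -> ->; exists z' => //; exact: mqE.
- by case=> e2 [_ z0]; rewrite z0 in nz.
by case=> e2 [_ z0]; rewrite z0 in nz.
Qed.

End WindowStep.

(** * The definite semigroup of bounded contexts *)

Section Contexts.
Variables (k : nat) (A : finType).

Definition window : finType := k.+1.-bseq A.

(** A nonempty word of length at most k+1, split into its last letter and what
    precedes.  The empty word is left out, as an identity would prevent the
    semigroup from being definite. *)
Definition context : Type := (k.-bseq A * A)%type.
HB.instance Definition _ := Finite.on context.

Fact size_lastn_leq n (s : seq A) : (size (lastn n s) <= n)%N.
Proof. by rewrite size_lastn geq_minl. Qed.

Definition cut n (s : seq A) : n.-bseq A := Bseq (size_lastn_leq n s).

Definition context_word (t : context) : seq A := rcons t.1 t.2.

Definition context_mul (t t' : context) : context :=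
  (cut k (context_word t ++ t'.1), t'.2).

Fact context_mulA : associative context_mul.
Proof.
move=> [u a] [v b] [w c]; congr (_, _); apply: val_inj.
rewrite /= /context_word /= -lastn_rcons lastn_catr lastn_catl //.
by rewrite rcons_cat catA.
Qed.
HB.instance Definition _ := isSemigroup.Build context context_mulA.

Definition slide (q : window) (t : context) : window :=
  cut k.+1 (q ++ context_word t).

Lemma slideM q t t' : slide q (t * t') = slide (slide q t) t'.
Proof.
apply: val_inj; rewrite /= lastn_catl // -catA.
by rewrite /context_word /= -lastn_rcons lastn_catr rcons_cat.
Qed.

Definition letter_context (a : A) : context := ([bseq], a).

(** An idempotent has full length, since the square of a shorter word is
    longer than the word; and a product that ends in a word of full length is
    this word. *)
Lemma context_definite : D context.
Proof.
move=> x [v b] [u a] [_ [eu]]; have [szu|szu] := ltnP (size u) k.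
  have := congr1 (fun w : k.-bseq A => size w) eu.
  rewrite /= size_lastn size_cat size_rcons; lia.
congr (_, _); apply: val_inj; rewrite /= /context_word lastn_suffix //=.
by rewrite lastn_id // size_bseq.
Qed.

End Contexts.

(** * Idempotents that may be inserted *)

Local Notation Some1 s := (Some s : adjoin1 _).

Section Words.
Variables (A : Type) (S : semigroupType).
Implicit Types (f : A -> S) (u v w : seq A).

Definition wval f w : adjoin1 S := word_value (fun a => Some1 (f a)) w.

Lemma wval_cat f u v : wval f (u ++ v) = wval f u * wval f v.
Proof. exact: big_cat. Qed.

Lemma wval_rcons f u a : wval f (rcons u a) = wval f u * Some1 (f a).
Proof. by rewrite -cats1 wval_cat; congr (_ * _); exact: big_seq1. Qed.

Lemma wval_nil f : wval f [::] = 1. Proof. exact: big_nil. Qed.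

Lemma wval_Some f a u : exists s, wval f (a :: u) = Some s.
Proof.
rewrite /wval /word_value big_cons; case: (\prod_(_ <- u) _)%g => [s|] /=.
  by exists (f a * s).
by exists (f a).
Qed.

Definition lact (u : adjoin1 S) (s : S) : S := if u is Some t then t * s else s.
Definition ract (s : S) (u : adjoin1 S) : S := if u is Some t then s * t else s.

Lemma Some_lact (u : adjoin1 S) s : Some (lact u s) = u * Some1 s.
Proof. by case: u. Qed.

Lemma Some_ract (u : adjoin1 S) s : Some (ract s u) = Some1 s * u.
Proof. by case: u. Qed.

End Words.

Lemma extend1M (S T : semigroupType) (h : S -> T) :
  {morph h : x y / x * y} -> {morph extend1 h : u v / u * v}.
Proof. by move=> hM [x|] [y|] //; congr Some; exact: hM. Qed.

Lemma extend1_wval (A : Type) (S T : semigroupType) (h : S -> T) (f : A -> S) w :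
  {morph h : x y / x * y} -> extend1 h (wval f w) = wval (fun a => h (f a)) w.
Proof.
move=> hM; elim/last_ind: w => [|w a IH]; first by rewrite !wval_nil.
by rewrite !wval_rcons extend1M // IH.
Qed.

(** An induction from left to right on words, extended to pseudowords. *)
Lemma ev_rind (B : Type) (R : finSemigroupType) (f : B -> R) (P : R -> Prop) :
  (forall b, P (f b)) -> (forall r b, P r -> P (r * f b)) ->
  forall x, P (ev f x).
Proof.
move=> Pf PM x; have [w] := ev_word f x; move: (ev f x).
elim/last_ind: w => [|w b IH] r; first by rewrite -[word_value _ _]/(wval f _) wval_nil.
rewrite -[word_value _ _]/(wval f _) wval_rcons.
case E: (wval f w) => [s|] [->]; last exact: Pf.
by apply: PM; exact: IH.
Qed.

Lemma kappa_lact (A : Type) (u : adjoin1 (OmegaS A)) x :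
  Omega_kappa1 u -> Omega_kappa x -> Omega_kappa (lact u x).
Proof. by case: u => [y|] //= ky kx; apply: kappa_mul => //; exact: ky. Qed.

Lemma kappa_ract (A : Type) (u : adjoin1 (OmegaS A)) x :
  Omega_kappa x -> Omega_kappa1 u -> Omega_kappa (ract x u).
Proof. by case: u => [y|] //= kx ky; apply: kappa_mul => //; exact: ky. Qed.

Lemma kappa_word (A : Type) (w : seq A) :
  Omega_kappa1 (wval (@Omega_gen all_semigroups A) w : adjoin1 (OmegaS A)).
Proof.
elim/last_ind: w => [|w a IH]; first by rewrite wval_nil.
rewrite wval_rcons -Some_lact => s [<-].
by apply: kappa_lact => //; exact: kappa_gen.
Qed.

Lemma ev_omega (A : Type) (S : finSemigroupType) (f : A -> S) (x : OmegaS A) :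
  exists n, ev f (omega x) = spow (ev f x) n.
Proof.
eexists; rewrite /ev val_omega /fin_omega (spow_morph _ _ (@of_copyM S)).
by [].
Qed.

Section Labels.
Variables (A : finType) (S : finSemigroupType) (gen : A -> S).
Notation W := (wval (@Omega_gen all_semigroups A)).
Notation dw := (wval gen).
Notation k := #|S|.

(** The last condition allows e to be inserted after p without changing the
    value in S. *)
Definition stabilizes (p : seq A) (e : OmegaS A) : Prop :=
  [/\ p <> [::], Omega_kappa e, e * e = e & dw p * Some1 (ev gen e) = dw p].

Definition stab (p : seq A) : option (OmegaS A) :=
  if pselect (exists e, stabilizes p e) is left h then Some (sval (cid h))
  else None.

Lemma stabP p e : stab p = Some e -> stabilizes p e.
Proof.
by rewrite /stab; case: pselect => // h [<-]; exact: (svalP (cid h)).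
Qed.

Lemma stab_nil : stab [::] = None.
Proof. by case E: (stab [::]) => [e|] //; have [] := stabP E. Qed.

Lemma stab_exists p e : stabilizes p e -> stab p.
Proof. by move=> pe; rewrite /stab; case: pselect => // -[]; exists e. Qed.

(** Among the |S|+2 prefixes of u, which take at most |S|+1 values in S^1, two
    have the same value; the idempotent power of the word between them
    stabilizes the longer one. *)
Lemma mark_long u : size u = k.+1 -> mark stab u.
Proof.
move=> su.
have : ~~ injectiveb (fun i : 'I_k.+2 => dw (take i u) : option S).
  apply/negP => /injectiveP inj.
  by have := leq_card _ inj; rewrite card_ord card_option ltnn.
case/injectivePn=> i [j neij eqij].
wlog lij : i j neij eqij / (i < j)%N.
  move=> H; case: (ltngtP i j) => [/H|/H|/val_inj eij]; first exact.
    by apply; rewrite 1?eq_sym.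
  by rewrite eij eqxx in neij.
set p := take j u; set y := drop i p.
have szp : size p = j by rewrite size_takel // su -ltnS.
have ep : p = take i u ++ y.
  by rewrite -[LHS](cat_take_drop i) /p take_takel // ltnW.
have [b [y' ey]] : exists b y', y = b :: y'.
  have : (0 < size y)%N by rewrite size_drop szp subn_gt0.
  by case: (y) => [|b y'] // _; exists b, y'.
have [x ex] := wval_Some (@Omega_gen all_semigroups A) b y'.
(* dw p = dw (take i u), and p = take i u ++ y *)
have dy : dw p * Some1 (ev gen x) = dw p.
  have -> : Some (ev gen x) = dw y.
    rewrite -[LHS]/(extend1 (ev gen) (Some x)) -ex -ey extend1_wval; last exact: evM.
    by congr wval; apply/funext => a; exact: ev_gen.
  have {}eqij : dw p = dw (take i u) by exact: esym.
  by rewrite eqij -wval_cat -ep.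
rewrite -(cat_take_drop j u) -/p; apply: mark_prefix.
  by move=> p0; move: szp lij; rewrite p0 => <-.
apply: (@stab_exists _ (omega x)); split.
- by move=> p0; move: szp lij; rewrite p0 => <-.
- apply: kappa_omega; apply: (@kappa_word _ (b :: y')); exact: ex.
- exact: omega_idem.
have [n ->] := ev_omega gen x.
elim: n => [//|n IH]; rewrite /= -[Some _]/(Some1 (ev gen x) * Some1 _).
by rewrite mulgA dy.
Qed.

End Labels.

(** * Transitions and what they emit *)

Section PathSemigroup.
Variables (Q : finType) (S : finSemigroupType).

(** Triples (source, target, value), and [None] as a zero for the product of
    paths that do not fit together. *)
Definition paths : Type := option (Q * Q * S).
HB.instance Definition _ := Finite.on paths.

Definition paths_mul (x y : paths) : paths :=
  if (x, y) is (Some (p, q, s), Some (q', r, t)) then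
    if q == q' then Some (p, r, s * t) else None
  else None.

Fact paths_mulA : associative paths_mul.
Proof.
move=> [[[p q] s]|] [[[q' r] t]|] [[[r' o] u]|] //; rewrite /paths_mul.
  case: (eqVneq r r') => [er|nr]; case: (eqVneq q q') => [eq|nq] //=;
    by rewrite ?er ?eq ?eqxx ?(negbTE nr) ?(negbTE nq) ?mulgA.
by case: (q == q').
Qed.
HB.instance Definition _ := isSemigroup.Build paths paths_mulA.

Lemma paths_mul_inv (x y : paths) p r u : x * y = Some (p, r, u) ->
  exists q s t, x = Some (p, q, s) /\ y = Some (q, r, t).
Proof.
rewrite -[x * y]/(paths_mul x y).
case: x y => [[[p' q] s]|] [[[q' r'] t]|] //; rewrite /paths_mul.
by case: (q =P q') => // <- [<- <- _]; exists q, s, t.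
Qed.

Lemma paths_mulE p q r s t :
  (Some (p, q, s) : paths) * Some (q, r, t) = Some (p, r, s * t).
Proof.
by rewrite -[LHS]/(paths_mul (Some (p, q, s)) (Some (q, r, t))) /paths_mul eqxx.
Qed.

End PathSemigroup.

Section Edges.
Variables (A : finType) (S : finSemigroupType) (gen : A -> S).
Notation W := (wval (@Omega_gen all_semigroups A)).
Notation dw := (wval gen).
Notation k := #|S|.
Notation Q := (window k A).
Notation mk := (mark (stab gen)).
Notation pend := (pending (stab gen)).

Definition step (q : Q) (a : A) : Q := slide q (letter_context k a).

Lemma stepE q a : step q a = lastn k.+1 (rcons q a) :> seq A.
Proof. by rewrite /= /context_word /= cats1. Qed.

(** What the transition emits.  If no factor can be stabilized, the letter
    itself; if the mark jumps to the end, the withheld letters and the new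
    idempotent; otherwise the current idempotent once more, as an edge must be a
    nonempty pseudoword. *)
Definition edge (b : Q * A) : OmegaS A :=
  match mk (step b.1 b.2) with
  | None => Omega_gen _ b.2
  | Some (e, [::]) => lact (W (rcons (pend b.1) b.2)) e
  | Some (e, _) => e
  end.

Lemma kappa_edge b : Omega_kappa (edge b).
Proof.
rewrite /edge; case E: (mk _) => [[e z]|]; last exact: kappa_gen.
have [x [p [_ /stabP [_ ke _ _]]]] := mark_spec E.
case: z {E} => //.
by apply: kappa_lact => //; exact: kappa_word.
Qed.

Variant edge_spec (q : Q) (a : A) : Prop :=
| EdgePlain of mk q = None & mk (step q a) = None &
    edge (q, a) = Omega_gen _ a & (step q a = rcons q a :> seq A)
| EdgeMark e of mk (step q a) = Some (e, [::]) &
    edge (q, a) = lact (W (rcons (pend q) a)) e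
| EdgeWait e z of mk q = Some (e, z) & mk (step q a) = Some (e, rcons z a) &
    edge (q, a) = e.

Lemma edgeP q a : edge_spec q a.
Proof.
have sq : (size q <= k.+1)%N by exact: size_bseq.
case E: (mk (step q a)) => [[e z]|].
  have [z0|nz] := pselect (z = [::]).
    by subst z; apply: (EdgeMark (e := e)); rewrite // /edge E.
  have := E; rewrite stepE => /(window_pending (@stab_nil _ _ gen) sq).
  case=> // z' ez mq; apply: (EdgeWait (e := e) (z := z')) => //.
    by rewrite E ez.
  by rewrite /edge E; case: (z) nz.
have := E; rewrite stepE => /(window_short (@stab_nil _ _ gen)
  (@mark_long _ _ gen)) [eq' mq].
by apply: EdgePlain => //; rewrite ?stepE // /edge E.
Qed.

(** The end of what has been emitted on arrival in the state q, which is all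
    that a definite semigroup sees of it. *)
Definition trail (q : Q) : adjoin1 (OmegaS A) :=
  if mk q is Some (e, _) then Some e else W q.

Definition edge_value (b : Q * A) : paths Q S :=
  Some (b.1, step b.1 b.2, ev gen (edge b)).

(** The invariant of the reading: w is the input, q the state, and s the value
    of what has been emitted. *)
Record tracked (w : seq A) (q : Q) (s : adjoin1 S) : Prop := Tracked {
  tracked_suffix : exists2 x, w = x ++ q & (mk q = None -> x = [::]);
  tracked_value : s * dw (pend q) = dw w;
  tracked_stable : forall e z, mk q = Some (e, z) -> s * Some1 (ev gen e) = s
}.

Lemma tracked_nil : tracked [::] [bseq] None.
Proof. by split=> //; exists [::]. Qed.

Lemma tracked_step w q a s : tracked w q s ->
  tracked (rcons w a) (step q a) (s * Some1 (ev gen (edge (q, a)))).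
Proof.
move=> [[x wx x0] val st].
have [y ey] : exists y, rcons w a = y ++ step q a.
  have [y ey] := cat_lastn k.+1 (rcons q a).
  by exists (x ++ y); rewrite stepE -catA -ey wx rcons_cat.
have [mq mq' eE eq'|e mq' eE|e z mq mq' eE] := edgeP q a.
- split=> [||e z]; last by rewrite mq'.
    by exists x; rewrite ?eq' ?wx ?rcons_cat // => _; exact: x0.
  rewrite /pending mq' eE ev_gen wval_nil mulg1 wval_rcons -val /pending mq.
  by rewrite wval_nil mulg1.
- have absorb : dw (rcons w a) * Some1 (ev gen e) = dw (rcons w a).
    (* the stabilized factor is a suffix of the window, hence of the input *)
    have [x' [p [ep /stabP [_ _ _ pe]]]] := mark_spec mq'.
    by rewrite ey ep cats0 catA wval_cat -mulgA pe.
  have sE : s * Some1 (ev gen (edge (q, a))) = dw (rcons w a).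
    rewrite eE.
    have -> : Some1 (ev gen (lact (W (rcons (pend q) a)) e)) =
        dw (rcons (pend q) a) * Some1 (ev gen e).
      rewrite -[LHS]/(extend1 (ev gen) (Some1 _)) Some_lact extend1M; last exact: evM.
      rewrite extend1_wval; last exact: evM.
      by congr (_ * _); congr wval; apply/funext => b; exact: ev_gen.
    by rewrite wval_rcons !mulgA val -wval_rcons absorb.
  split=> [||e' z]; last 1 first.
  + by rewrite mq' => -[<- _]; rewrite sE.
  + by exists y => //; rewrite mq'.
  + by rewrite sE /pending mq' wval_nil mulg1.
rewrite eE (st _ _ mq); split=> [||e' z']; last 1 first.
- by rewrite mq' => -[<- _]; exact: st mq.
- by exists y => //; rewrite mq'.
by rewrite /pending mq' wval_rcons wval_rcons -val /pending mq mulgA.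
Qed.

Definition window_of (x : OmegaS A) : Q :=
  slide ([bseq] : Q) (ev (@letter_context k A) x).

Definition reading (x : OmegaS A) : OmegaS (Q * A) :=
  read (@slideM k A) (@letter_context k A) ([bseq] : Q) x.

(** The invariant [tracked], proved for words, passes to pseudowords because
    the two values involved are computed in one finite semigroup. *)
Lemma reading_value (x : OmegaS A) : exists s,
  ev edge_value (reading x) = Some ([bseq], window_of x, s) /\
  Some1 s * dw (pend (window_of x)) = Some1 (ev gen x).
Proof.
pose Wr := wreath (@slideM k A) (paths Q S).
pose rl : A -> Wr := read_letter (@slideM k A) (@letter_context k A) edge_value.
pose f a : (Wr * S)%type := (rl a, gen a).
pose P (r : Wr * S) := exists s w, [/\ r.1.1 [bseq] =
    Some ([bseq], slide ([bseq] : Q) r.1.2, s),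
    tracked w (slide ([bseq] : Q) r.1.2) (Some s) & dw w = Some r.2].
have : P (ev f x).
  apply: ev_rind => [a|[r1 r2] a [s [w [rE tr dwE]]]].
    exists (ev gen (edge ([bseq], a))), [:: a]; split.
    - by rewrite ffunE.
    - exact: (tracked_step a tracked_nil).
    - by rewrite -[[:: a]]/(rcons [::] a) wval_rcons wval_nil.
  set q := slide ([bseq] : Q) r1.2 in rE tr.
  have eqs : slide ([bseq] : Q) (r1 * rl a).2 = step q a by exact: slideM.
  exists (s * ev gen (edge (q, a))), (rcons w a); split.
  - rewrite -[X in slide _ X]/((r1 * rl a).2) eqs -[LHS]/((r1 * rl a).1 _).
    by rewrite wreathM rE ffunE paths_mulE.
  - by rewrite -[X in slide _ X]/((r1 * rl a).2) eqs; exact: tracked_step tr.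
  - by rewrite wval_rcons dwE.
have -> : ev f x = (ev rl x, ev gen x).
  by rewrite [ev f x]surjective_pairing (@ev_comp _ _ _ fst) // (@ev_comp _ _ _ snd).
case=> s [w [/= rE [_ val _] dwE]]; exists s.
have eW : (ev rl x).2 = ev (@letter_context k A) x by exact: read_letter_snd.
rewrite /reading ev_read; split; last by rewrite /window_of -eW val dwE.
by rewrite rE eW.
Qed.

(** * Images of paths in semidirect products *)

Section Decoding.
Variables (U R : finSemigroupType) (act : R -> U -> U) (actP : left_action act).
Hypothesis RD : D R.
Variable F : A -> semidirect_of actP.
Let F2 (a : A) : R := (F a).2.

(** The extension of the action to R with an identity adjoined. *)
Definition act1 (t : adjoin1 R) (s : U) : U := if t is Some r then act r s else s.

Lemma act1M t s s' : act1 t (s * s') = act1 t s * act1 t s'.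
Proof. by case: t => //= r; exact: act_endo actP _ _ _. Qed.

Lemma act1_act t r s : act1 t (act r s) = act1 (t * Some1 r) s.
Proof. by case: t => //= t; rewrite (act_mul actP). Qed.

Definition trail_value (q : Q) : adjoin1 R := extend1 (ev F2) (trail q).

Lemma definite_idem (t e : R) : e * e = e -> t * e = e.
Proof.
move=> ee; apply: (RD (x := e)); split=> //.
by move=> B [_ gB]; exact: gB.
Qed.

Lemma ev_F2 (x : OmegaS A) : (ev F x).2 = ev F2 x.
Proof. exact: (@ev_comp _ (semidirect_of actP) R snd). Qed.

(** The trail of a marked state is an idempotent, hence a right zero in every
    member of D. *)
Lemma trail_step q a :
  trail_value q * Some1 (ev F2 (edge (q, a))) = trail_value (step q a).
Proof.
have absorb (t : adjoin1 R) p e : stab gen p = Some e ->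
    t * Some1 (ev F2 e) = Some1 (ev F2 e).
  case/stabP => _ _ ee _; case: t => //= t; congr Some.
  by apply: definite_idem; rewrite -evM ee.
have absorbm (t : adjoin1 R) p e z : mk p = Some (e, z) ->
    t * Some1 (ev F2 e) = Some1 (ev F2 e).
  by move=> mp; have [_ [p' [_ sp]]] := mark_spec mp; exact: absorb sp.
rewrite /trail_value /trail.
have [mq mq' eE eq'|e mq' eE|e z mq mq' eE] := edgeP q a; rewrite mq' eE.
- by rewrite mq eq' wval_rcons extend1M; [rewrite /= ?ev_gen|exact: evM].
- rewrite -[Some1 (ev F2 (lact _ _))]/(extend1 (ev F2) (Some1 _)) Some_lact.
  by rewrite extend1M ?mulgA; [exact: absorbm mq'|exact: evM].
- exact: absorbm mq'.
Qed.

(** In a product of edges the U-component of an edge is acted upon by the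
    R-component of all that precedes, which is the trail of its source. *)
Definition edge_action (b : Q * A) : U :=
  act1 (trail_value b.1) (ev F (edge b)).1.

(** The two identities define a subsemigroup of the product of the three
    semigroups in which r is evaluated, so that they need only be checked on
    edges, where they are [trail_step] and the definition of [edge_action]. *)
Lemma decode_path (r : OmegaS (Q * A)) q q' s :
  ev edge_value r = Some (q, q', s) ->
  trail_value q * Some1 (ev F (subst edge r)).2 = trail_value q' /\
  act1 (trail_value q) (ev F (subst edge r)).1 = ev edge_action r.
Proof.
pose g b : (paths Q S * semidirect_of actP * U)%type :=
  (edge_value b, ev F (edge b), edge_action b).
pose C : set (paths Q S * semidirect_of actP * U)%type := fun v =>
  forall q q' s, v.1.1 = Some (q, q', s) ->
  trail_value q * Some1 v.1.2.2 = trail_value q' /\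
  act1 (trail_value q) v.1.2.1 = v.2.
have Cg : C (ev g r).
  apply: ev_mem => [[[x1 y1] z1] [[x2 y2] z2] C1 C2|[p a]].
    move=> p p' t /= /paths_mul_inv [o [t1 [t2 [e1 e2]]]].
    have [/= h1 h1'] := C1 _ _ _ e1; have [/= h2 h2'] := C2 _ _ _ e2.
    split; first by rewrite -h2 -h1 -mulgA.
    by rewrite act1M act1_act h1 h1' h2'.
  by move=> _ _ _ [<- <- _]; split=> //=; rewrite ev_F2 trail_step.
have eg : ev g r = (ev edge_value r, ev F (subst edge r), ev edge_action r).
  have g1 : (ev g r).1 = ev (fun b => (g b).1) r.
    exact: (@ev_comp _ _ (paths Q S * semidirect_of actP)%type fst).
  rewrite ev_subst [ev g r]surjective_pairing g1 [X in (X, _)]surjective_pairing.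
  by congr (_, _, _); [exact: (@ev_comp _ _ (paths Q S) fst)
    | exact: (@ev_comp _ _ (semidirect_of actP) snd) | exact: (@ev_comp _ _ U snd)].
by rewrite eg in Cg; exact: Cg.
Qed.

Lemma trail_nil : trail_value [bseq] = None.
Proof. by rewrite /trail_value /trail /= wval_nil. Qed.

Lemma decode_reading (r : OmegaS (Q * A)) q s :
  ev edge_value r = Some ([bseq], q, s) ->
  Some1 (ev F (subst edge r)).2 = trail_value q /\
  (ev F (subst edge r)).1 = ev edge_action r.
Proof. by move=> /decode_path; rewrite trail_nil. Qed.

End Decoding.

End Edges.

(** * Passing from V*D to V and back *)

Lemma generated_pv_pseudovariety (K : semigroup_class) :
  pseudovariety (generated_pv K).
Proof.
split=> [S S1|S T KS KT|S T f injf KT|S T f surjf KS] V pvV KV.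
- exact: (pv_trivial pvV).
- by apply: (pv_prod pvV); [exact: KS|exact: KT].
- by apply: (pv_sub pvV (f := f) injf); exact: KT.
- by apply: (pv_image pvV (f := f) surjf); exact: KS.
Qed.

(** Together with the definition of a generated pseudovariety, this reduces
    equality over it to the generators. *)
Lemma identity_pseudovariety (A : Type) (x y : OmegaS A) :
  pseudovariety (fun S : finSemigroupType =>
    forall f : A -> S, ev f x = ev f y).
Proof.
split=> [S S1 f|S T xyS xyT f|S T h injh xyT f|S T h surjh xyS f].
- have /card_le1P/(_ (ev f x) erefl) sub1 : (#|S| <= 1)%N by rewrite S1.
  by have := sub1 (ev f y); rewrite inE => /esym/eqP ->.
- rewrite [LHS]surjective_pairing [RHS]surjective_pairing.
  by rewrite !(@ev_comp _ _ S fst) // !(@ev_comp _ _ T snd) // xyS xyT.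
- by apply: injh; rewrite !ev_comp ?xyT //; exact: gmulfM.
have [a|g gf] := @choice A S (fun a s => h s = f a).
  have : range h (f a) by rewrite surjh.
  by case=> s _ <-; exists s.
have -> : f = (fun a => h (g a)) by apply/funext => a; rewrite gf.
by rewrite -!ev_comp ?xyS //; exact: gmulfM.
Qed.

Lemma generated_pv_eq (K : semigroup_class) (A : Type) (x y : OmegaS A) :
  (forall (S : finSemigroupType) (f : A -> S), K S -> ev f x = ev f y) ->
  pV (generated_pv K) x = pV (generated_pv K) y.
Proof.
move=> xyK; apply/(pV_eqP _ _ (generated_pv_pseudovariety K)) => S f KS.
apply: (KS _ (identity_pseudovariety x y)) => T KT g; exact: xyK.
Qed.

Lemma path_value_subst (A : finType) (S : finSemigroupType) (gen : A -> S)
    (r : OmegaS (window #|S| A * A)) q q' s :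
  ev (edge_value gen) r = Some (q, q', s) -> ev gen (subst (edge gen) r) = s.
Proof.
pose g b : (paths (window #|S| A) S * S)%type :=
  (edge_value gen b, ev gen (edge gen b)).
have : [set v : paths (window #|S| A) S * S | forall q q' s,
    v.1 = Some (q, q', s) -> v.2 = s] (ev g r).
  apply: ev_mem => [[x1 y1] [x2 y2] C1 C2|b]; last by move=> _ _ _ [_ _ <-].
  move=> p p' t /= e; have := e.
  have [o [t1 [t2 [e1 e2]]]] := paths_mul_inv e.
  rewrite e1 e2 paths_mulE => -[<-].
  by have /= -> := C1 _ _ _ e1; have /= -> := C2 _ _ _ e2.
rewrite [ev g r]surjective_pairing (@ev_comp _ _ S snd) // (@ev_comp _ _ _ fst) //.
by rewrite ev_subst => C; exact: C.
Qed.

Section Transfer.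
Variables (V : semigroup_class) (pvV : pseudovariety V).
Variables (A : finType) (S : finSemigroupType) (gen : A -> S).
Implicit Types x y : OmegaS A.
Notation VD := (semidirect_pv V D).
Notation Q := (window #|S| A).

(** The wreath product of U by the contexts belongs to V*D. *)
Lemma ev_read_letter_eq x y : pV VD x = pV VD y ->
  forall (U : finSemigroupType) (g : Q * A -> U), V U ->
  let rl := read_letter (@slideM #|S| A) (@letter_context #|S| A) g in
  ev rl x = ev rl y.
Proof.
move=> xy U g VU rl.
have [/(_ xy) H _] := pV_eqP x y (generated_pv_pseudovariety (semidirect_products V D)).
apply: H; apply: wreath_in => //; exact: context_definite.
Qed.

Lemma reading_eq x y : pV VD x = pV VD y ->
  pV V (reading S x) = pV V (reading S y).
Proof.
move=> xy; apply/pV_eqP => // U g VU.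
by rewrite !ev_read (ev_read_letter_eq xy g VU).
Qed.

(** The trivial semigroup, a member of V, already gives access to the contexts
    inside V*D. *)
Lemma window_eq x y : pV VD x = pV VD y ->
  window_of S x = window_of S y.
Proof.
move=> xy; pose U : finSemigroupType := @OrdSemigroup 1 (fun i j => i)
  (fun i j l => erefl).
have VU : V U by apply: (pv_trivial pvV); exact: card_ord.
have := ev_read_letter_eq xy (fun _ : Q * A => ord0 : U) VU.
by move=> /(congr1 snd); rewrite /= !read_letter_snd /window_of => ->.
Qed.

Lemma subst_edge_eq (r r' : OmegaS (Q * A)) q s s' :
  pV V r = pV V r' ->
  ev (edge_value gen) r = Some ([bseq], q, s) ->
  ev (edge_value gen) r' = Some ([bseq], q, s') ->
  pV VD (subst (edge gen) r) = pV VD (subst (edge gen) r').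
Proof.
move=> /(pV_eqP _ _ pvV) rr' rv rv'; apply: generated_pv_eq => T f VDT.
case: VDT f => U R act actP VU RD f.
have [e2 e1] := decode_reading RD f rv.
have [e2' e1'] := decode_reading RD f rv'.
rewrite [LHS]surjective_pairing [RHS]surjective_pairing e1 e1' (rr' _ _ VU).
by congr (_, _); apply: Some_inj; rewrite e2 e2'.
Qed.

End Transfer.

Theorem corollary6p3 (V : semigroup_class) (V_pv : pseudovariety V)
    (V_not_sub_LI : ~ (forall S : finSemigroupType, V S -> LI S))
    (V_reducible : pointlike_kappa_reducible V) :
  pointlike_kappa_reducible (semidirect_pv V D).
Proof.
move=> m m2 A S gen _ delta [delta_cont delta_gen] phi [eta [etaE eta_eq]].
have deltaE : delta =1 ev gen.
  by apply: ev_unique => //; exact: gmulfM.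
have single (M : monoidType) (f : 'I_m -> M) i : word_value f [:: i] = f i.
  exact: big_seq1.
have sys u v : (u, v) \in pointlike_system m ->
    exists i j, u = [:: i] /\ v = [:: j].
  by case/mapP=> -[i j] _ [-> ->]; exists i, j.
pose rho i := extend1 (reading S) (eta i).
have rho_eq u v : (u, v) \in pointlike_system m ->
    models_eq V (word_value rho u) (word_value rho v).
  move=> uv; have := eta_eq _ _ uv; have [i [j [-> ->]]] := sys _ _ uv.
  rewrite !single /models_eq /rho.
  case: (eta i) (eta j) => [x|] [y|] // xy; congr Some.
  by apply: reading_eq => //; exact: Some_inj xy.
have [rho' [[rho'E rho'_eq] krho']] :=
  reducible_ev (edge_value gen) (V_reducible m m2) rho_eq.
(* the reading withholds the letters after the last mark: they are put back *)
pose eta' i : adjoin1 (OmegaS A) :=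
  if eta i is Some x then
    if rho' i is Some r then
      Some (ract (subst (edge gen) r) (wval (@Omega_gen all_semigroups A)
        (pending (stab gen) (window_of S x))))
    else None
  else None.
exists eta'; split; last first.
  move=> i s; rewrite /eta'; case: (eta i) => // x; have := krho' i.
  case: (rho' i) => // r kr [<-]; apply: kappa_ract; last exact: kappa_word.
  by apply: kappa_subst; [exact: kappa_edge|exact: kr].
split=> [i|u v uv].
  rewrite -etaE /eta'; have := rho'E i; rewrite /rho.
  case: (eta i) => [x|] //; case: (rho' i) => [r|] // /Some_inj rE.
  have [s [xs xE]] := reading_value gen x.
  rewrite /= !deltaE -[RHS]/(Some1 (ev gen x)) -xE.
  rewrite -[LHS]/(extend1 (ev gen) (Some1 (ract _ _))) Some_ract extend1M; last exact: evM.
  rewrite extend1_wval; last exact: evM.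
  congr (_ * _); last by congr wval; apply/funext => a; exact: ev_gen.
  by congr Some; apply: path_value_subst; rewrite rE xs.
have := rho'_eq _ _ uv; have := eta_eq _ _ uv.
have [i [j [-> ->]]] := sys _ _ uv.
rewrite !single /models_eq /eta'; have := rho'E i; have := rho'E j.
rewrite /rho; case: (eta i) (eta j) => [x|] [y|] //.
case: (rho' i) (rho' j) => [r|] [r'|] // /Some_inj r'E /Some_inj rE.
move=> /Some_inj xy /Some_inj rr'.
have [s [xs _]] := reading_value gen x; have [s' [ys _]] := reading_value gen y.
have wxy := window_eq V_pv S xy; rewrite -wxy in ys *.
rewrite -rE in xs; rewrite -r'E in ys.
rewrite !Some_ract !extend1M; [|exact: pVM|exact: pVM].
by congr (_ * _); congr Some; exact: subst_edge_eq xs ys.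
Qed.
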